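(* Let $d=d(n)$ and $n$ be positive integers with $d=\omega(1)$, and suppose there is a constant $a>0$ such that $d\le n^{1-a}$. Let $\epsilon>0$ be a sufficiently small constant and let $k\in\mathbb{N}$ be a constant. Then for every constant $c>0$ there exists a sufficiently large constant $C=C(c,k)>0$ such that the following holds. Let $G=(V,E)$ be a $d$-regular graph on $n$ vertices satisfying: (P1) for every $U\subseteq V$ with $|U|\le n/2$, $e(U,U^C)\ge c|U|$; and (P2) for every $U\subseteq V$ with $|U|\le Cd\log n$, $e(U,U^C)\ge (1-\epsilon)d|U|$. Consider the random graph process on $G$, let $\tau_k$ be the hitting time of having minimum degree at least $k$, and let $\tau_{kc}$ be the hitting time of being $k$-connected. Then, with high probability, $\tau_k=\tau_{kc}$.
   Context: All asymptotics are as $n\to\infty$; a statement holds ''with high probability'' (whp) if its probability tends to $1$ as $n\to\infty$. Statements about ''a $d$-regular $n$-vertex graph'' are to be understood for sequences $(d_k,n_k)$ and corresponding sequences of graphs. For $U\subseteq V$, $U^C=V\setminus U$ and $e(U,U^C)$ is the number of edges of $G$ with exactly one endpoint in $U$. Logarithms are natural. The random graph process on $G=(V,E)$: $G(0)$ is the empty graph on $V$, and for $1\le i\le |E|$, $G(i)$ is obtained from $G(i-1)$ by adding an edge chosen uniformly at random from $E\setminus E(G(i-1))$. The hitting time of a monotone increasing graph property $\mathcal{P}$ is the minimum index $\tau$ with $G(\tau)\in\mathcal{P}$. *)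

(* Defs.v *)
From mathcomp Require Import all_boot all_order all_algebra.

Set Implicit Arguments.
Unset Strict Implicit.
Unset Printing Implicit Defensive.

Import GRing.Theory.

Section Graphs.
Variable T : finType.

(* A graph on the vertex set T is given by its edge set; an edge is the
   two-element set of its endpoints. *)
Definition simple_graph (E : {set {set T}}) : Prop :=
  forall e, e \in E -> #|e| = 2.

Definition degree (E : {set {set T}}) (v : T) : nat :=
  #|[set e in E | v \in e]|.

Definition regular (d : nat) (E : {set {set T}}) : Prop :=
  forall v, degree E v = d.

(* e(U, U^C) *)
Definition edge_boundary (E : {set {set T}}) (U : {set T}) : nat :=
  #|[set e in E | #|e :&: U| == 1]|.

Definition min_degree_ge (k : nat) (E : {set {set T}}) : bool :=
  [forall v, k <= degree E v].

Definition adj_avoiding (E : {set {set T}}) (S : {set T}) : rel T :=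
  [rel x y | [&& x \notin S, y \notin S & [set x; y] \in E]].

(* More than k vertices, and G - S is connected whenever |S| < k. *)
Definition k_connected (k : nat) (E : {set {set T}}) : bool :=
  (k < #|T|) &&
  [forall S : {set T}, (#|S| < k) ==>
     [forall x in ~: S, forall y in ~: S, connect (adj_avoiding E S) x y]].

(* A trajectory of the random graph process on E is recorded by the tuple of
   the successively added edges; [graph_at s i] is G(i). *)
Definition graph_at (s : seq {set T}) (i : nat) : {set {set T}} :=
  [set:: take i s].

(* The conditional probability that the next edge is e when the current graph
   is H. *)
Definition step_prob (R : realFieldType) (E H : {set {set T}}) (e : {set T})
    : R :=
  if e \in E :\: H then (#|E :\: H|%:R)^-1%R else 0%R.

Definition trajectory_prob (R : realFieldType) (E : {set {set T}})
    (s : #|E|.-tuple {set T}) : R :=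
  (\prod_(i < #|E|) step_prob R E (graph_at s i) (tnth s i))%R.

Definition process_prob (R : realFieldType) (E : {set {set T}})
    (A : pred (#|E|.-tuple {set T})) : R :=
  (\sum_(s | A s) trajectory_prob R s)%R.

(* The least i <= |E| with P (G(i)), and |E| + 1 if there is none. *)
Definition hitting_time (E : {set {set T}}) (P : pred {set {set T}})
    (s : #|E|.-tuple {set T}) : nat :=
  find (fun i => P (graph_at s i)) (iota 0 #|E|.+1).

End Graphs.

(* Main.v *)
Require Import Defs.
From mathcomp Require Import all_boot all_order all_algebra.
From mathcomp Require Import ring lra zify.

Set Implicit Arguments.
Unset Strict Implicit.
Unset Printing Implicit Defensive.

Import Order.TTheory GRing.Theory Num.Theory.
Local Open Scope ring_scope.

(** A Bernoulli subset of E conditioned on its size m is distributed as G(m),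
    so it suffices to show that a random G = H0 u H1 u H2, the union of three
    independent Bernoulli subsets of E, has with high probability an isolated
    vertex, while every G <= K <= E of minimum degree at least k is
    k-connected. Here an edge is missing from H0 with probability
    n^(-(1-b/4)/d), and from H1 and H2 with probability e^(-4/d) and e^(-1/d).

    With high probability every connected W in H0 with 2 <= |W| <= C d log n
    has more than k|W| boundary edges in H0 (first moment over breadth-first
    search codes, using P2), and no two vertices of H0-degree below k are
    adjacent in E. Hence for |S| < k the components of H0 - S are either larger
    than C d log n or single vertices, and the latter form an independent set J
    of E. A disconnection of K - S thus separates the large components into two
    nonempty classes X and Y. Attaching each vertex of J to the class in which
    it has more neighbours, P1 yields at least c|X| - kd edges that either join
    X to Y or join a vertex of J to its minority class. If H1 links a vertex of
    J to its majority class and H2 uses one of its minority edges, then X and Y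
    are connected; so the probability that H1 and H2 link X and Y nowhere is at
    most n^(-(k+2)) to the number of components in X, which beats the union
    bound over S and X. The second moment method gives the isolated vertex. *)

(** * Bernoulli subsets *)

Section Bernoulli.
Variables (R : realFieldType) (F : finType) (E : {set F}).
Implicit Types (q x : R) (A B H K : {set F}) (f g : {set F} -> R).

(** The parameter is the probability of absence, not of presence, so that the parameters of
    independent rounds multiply when the rounds are united. *)
Definition bweight q H : R := \prod_(e in E) (if e \in H then 1 - q else q).

Definition bexp q f : R := \sum_(H in powerset E) bweight q H * f H.

Lemma sum_subset_prod (a b : F -> R) :
  \sum_(H in powerset E) \prod_(e in E) (if e \in H then a e else b e)
  = \prod_(e in E) (a e + b e).
Proof.
(* Outside [E] the factors are 0 and 1, so in the expansion over all sets only the subsets of [E]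
   survive. *)
pose a' e := if e \in E then a e else 0.
pose b' e := if e \in E then b e else 1.
transitivity (\prod_e (a' e + b' e)); last first.
  rewrite [RHS]big_mkcond; apply: eq_bigr => e _.
  by rewrite /a' /b'; case: ifP => // _; rewrite add0r.
rewrite bigA_distr [RHS](bigID (fun H : {set F} => H \in powerset E)) /=.
rewrite [X in _ = _ + X]big1 ?addr0 => [|H HnE]; last first.
  have [e eH eE] : exists2 e, e \in H & e \notin E.
    by apply/subsetPn; rewrite powersetE in HnE.
  by rewrite (bigD1 e) //= eH /a' (negbTE eE) mul0r.
apply: eq_big => [H|H HE]; first by [].
rewrite big_mkcond; apply: eq_bigr => e _; rewrite /a' /b'.
case: ifP => // eE; case: ifP => // eH.
by move: HE; rewrite powersetE => /subsetP/(_ _ eH); rewrite eE.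
Qed.

Lemma bexp_prod q (a b : F -> R) :
  bexp q (fun H => \prod_(e in E) (if e \in H then a e else b e))
  = \prod_(e in E) ((1 - q) * a e + q * b e).
Proof.
rewrite -sum_subset_prod; apply: eq_bigr => H _.
by rewrite -big_split; apply: eq_bigr => e _ /=; case: ifP.
Qed.

Lemma eq_bexp q f g : (forall H, H \subset E -> f H = g H) -> bexp q f = bexp q g.
Proof. by move=> fg; apply: eq_bigr => H; rewrite powersetE => /fg->. Qed.

Lemma bexp_cst q x : bexp q (fun=> x) = x.
Proof.
rewrite /bexp -big_distrl /= sum_subset_prod big1 ?mul1r // => e _.
by rewrite subrK.
Qed.

Lemma bexpZ q x f : bexp q (fun H => x * f H) = x * bexp q f.
Proof. by rewrite /bexp big_distrr; apply: eq_bigr => H _; rewrite mulrCA. Qed.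

Lemma bexpD q f g : bexp q (fun H => f H + g H) = bexp q f + bexp q g.
Proof. by rewrite /bexp -big_split; apply: eq_bigr => H _; rewrite mulrDr. Qed.

Lemma bexp_sum q (I : Type) (r : seq I) (P : pred I) (f : I -> {set F} -> R) :
  bexp q (fun H => \sum_(i <- r | P i) f i H) = \sum_(i <- r | P i) bexp q (f i).
Proof.
by rewrite /bexp exchange_big; apply: eq_bigr => H _; rewrite big_distrr.
Qed.

Section Monotone.
Variable q : R.
Hypothesis q01 : 0 <= q <= 1.

Lemma bweight_ge0 H : 0 <= bweight q H.
Proof. by case/andP: q01 => q0 q1; apply: prodr_ge0 => e _; case: ifP => _; lra. Qed.

Lemma ler_bexp f g : (forall H, H \subset E -> f H <= g H) -> bexp q f <= bexp q g.
Proof.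
move=> fg; apply: ler_sum => H; rewrite powersetE => HE.
by rewrite ler_wpM2l ?bweight_ge0 ?fg.
Qed.

End Monotone.

Lemma prod_cond_expr (P : {set F}) x :
  P \subset E -> \prod_(e in E) (if e \in P then x else 1) = x ^+ #|P|.
Proof.
move=> PE; rewrite -big_mkcondr -prodr_const; apply: eq_bigl => e.
by rewrite andbC; case: (boolP (e \in P)) => //= /(subsetP PE).
Qed.

(** The expectation factorises over the elements of [E]. The factor [x ^+ #|B :&: H|] is an
    exponential moment from which lower tails for the number of elements of [B] in [H] follow. *)
Lemma bexp_tree q x A B : A \subset E -> B \subset E -> [disjoint A & B] ->
  bexp q (fun H => (A \subset H)%:R * x ^+ #|B :&: H|)
  = (1 - q) ^+ #|A| * (q + (1 - q) * x) ^+ #|B|.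
Proof.
move=> AE BE dAB.
pose b e : R := if e \in A then 0 else 1.
pose a e : R := if e \in B then x else 1.
transitivity (bexp q (fun H => \prod_(e in E) (if e \in H then a e else b e))).
  apply: eq_bexp => H HE; case: (boolP (A \subset H)) => [AH|]; last first.
    case/subsetPn=> e eA eH; rewrite mul0r (bigD1 e) ?(subsetP AE) //=.
    by rewrite (negbTE eH) /b eA mul0r.
  rewrite mul1r -prod_cond_expr; last exact: subset_trans (subsetIl _ _) BE.
  apply: eq_bigr => e _; rewrite inE /a /b.
  case: (boolP (e \in H)) => eH; first by rewrite andbT.
  rewrite andbF; case: ifP => // eA.
  by rewrite (subsetP AH _ eA) in eH.
rewrite bexp_prod -(prod_cond_expr _ AE) -(prod_cond_expr _ BE) -big_split.
apply: eq_bigr => e _; rewrite /a /b /=.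
case: (boolP (e \in A)) => eA.
  by rewrite (disjointFr dAB eA); ring.
by case: ifP => _; ring.
Qed.

(** This is [bexp_tree] with empty [A] and [x = 0], since [0 ^+ m] is the indicator of [m = 0]. *)
Lemma bexp_absent q B : B \subset E ->
  bexp q (fun H => [disjoint B & H]%:R) = q ^+ #|B|.
Proof.
move=> BE; have := bexp_tree q 0 (sub0set E) BE.
rewrite cards0 mulr0 addr0 expr0 mul1r => <-;
  last by rewrite disjoint_sym disjoints_subset setC0 ?subsetT.
apply: eq_bexp => H _; rewrite sub0set mul1r expr0n cards_eq0 setI_eq0.
by [].
Qed.

(** An element is missing from the union exactly when both rounds miss it. By linearity it suffices
    to treat the indicator of a single set [K], which factorises. *)
Lemma bexp_union q q' f :
  bexp q (fun H => bexp q' (fun H' => f (H :|: H'))) = bexp (q * q') f.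
Proof.
transitivity (bexp q (fun H => bexp q' (fun H' =>
   \sum_(K in powerset E) f K * (H :|: H' == K)%:R))).
  apply: eq_bexp => H HE; apply: eq_bexp => H' H'E.
  rewrite (bigD1 (H :|: H')) ?powersetE ?subUset ?HE //= eqxx mulr1.
  rewrite big1 ?addr0 // => K /andP[_ KH].
  by rewrite [_ == K]eq_sym (negbTE KH) mulr0.
transitivity (\sum_(K in powerset E) f K * bexp q (fun H => bexp q' (fun H' =>
   (H :|: H' == K)%:R))).
  under eq_bexp => H _.
    rewrite bexp_sum; under eq_bigr do rewrite bexpZ. over.
  by rewrite bexp_sum; apply: eq_bigr => K _; rewrite bexpZ.
apply: eq_bigr => K; rewrite powersetE => KE; rewrite mulrC; congr (_ * _).
(* For fixed [H], an element of [H] must lie in [K], and any other element must lie in [H'] exactly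
   when it lies in [K]. *)
transitivity (bexp q (fun H => \prod_(e in E) if e \in H then (e \in K)%:R else
    (if e \in K then 1 - q' else q'))).
  apply: eq_bexp => H HE.
  pose a e : R := (e \in K)%:R.
  pose b e : R := ((e \in H) == (e \in K))%:R.
  transitivity (bexp q' (fun H' => \prod_(e in E) (if e \in H' then a e else b e))).
    apply: eq_bexp => H' H'E; case: eqP => [HK|/eqP].
      rewrite big1 // => e _; rewrite /a /b -HK !inE.
      case: (boolP (e \in H')) => eH'; first by rewrite orbT.
      by rewrite orbF eqxx.
    move=> HK; have [e] : exists e, (e \in H :|: H') != (e \in K).
      apply/existsP; rewrite -[X in is_true X]negbK; apply: contra HK.
      by rewrite negb_exists => /forallP h; apply/eqP/setP => e; have := h e; rewrite negbK => /eqP.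
    move=> he; have eE : e \in E.
      apply: contraR he => eE; rewrite !inE.
      have -> : e \in H = false by apply: contraNF eE => /(subsetP HE).
      have -> : e \in H' = false by apply: contraNF eE => /(subsetP H'E).
      have -> : e \in K = false by apply: contraNF eE => /(subsetP KE).
      by [].
    rewrite (bigD1 e) //= /a /b; move: he; rewrite !inE.
    by case: (e \in H); case: (e \in H'); case: (e \in K); rewrite //= mul0r.
  rewrite bexp_prod; apply: eq_bigr => e _; rewrite /a /b.
  by case: (e \in H); case: (e \in K) => /=; rewrite ?mulr0 ?mulr1 ?addr0 ?add0r ?subrK.
rewrite bexp_prod; apply: eq_bigr => e _.
by case: ifP => _ /=; ring.
Qed.

End Bernoulli.

(** * The random graph process *)

Lemma bweightE (R : realFieldType) (F : finType) (E K : {set F}) (q : R) :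
  K \subset E -> bweight E q K = (1 - q) ^+ #|K| * q ^+ (#|E| - #|K|).
Proof.
move=> KE; rewrite /bweight (bigID (mem K)) /= -!prodr_const.
congr (_ * _).
  rewrite big_andbC; under eq_bigl => e do rewrite -in_setI (setIidPl KE).
  by apply: eq_bigr => e ->.
have -> : (#|E| - #|K|)%N = #|E :\: K|.
  by rewrite cardsD (setIidPr KE).
rewrite -prodr_const; apply: eq_big => e; first by rewrite inE andbC.
by case/andP=> _ /negbTE->.
Qed.

Lemma nth_notin_take_uniq (U : eqType) (x0 : U) (s : seq U) :
  (forall i, (i < size s)%N -> nth x0 s i \notin take i s) -> uniq s.
Proof.
elim/last_ind: s => // s x IH h; rewrite rcons_uniq; apply/andP; split.
  have := h (size s); rewrite size_rcons => /(_ (leqnn _)).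
  by rewrite nth_rcons ltnn eqxx -cats1 take_size_cat.
apply: IH => i lti; have := h i; rewrite size_rcons => /(_ (leqW lti)).
by rewrite nth_rcons lti -cats1 take_cat lti.
Qed.

Section Process.
Variables (R : realFieldType) (T : finType) (E : {set {set T}}).
Local Notation N := #|E|.
Implicit Types (s : N.-tuple {set T}) (K : {set {set T}}).

Definition ordering s := uniq s && all (mem E) s.

Lemma graph_at_sub s m : ordering s -> graph_at s m \subset E.
Proof.
case/andP=> _ /allP sE; apply/subsetP => e; rewrite inE => /mem_take; exact: sE.
Qed.

Lemma card_graph_at s m : ordering s -> (m <= N)%N -> #|graph_at s m| = m.
Proof.
case/andP=> us _ mN; rewrite cardsE; move/card_uniqP: (take_uniq m us) => ->.
by rewrite size_takel // size_tuple.
Qed.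

(** On an ordering, step [i] chooses among [N - i] remaining edges, and the reciprocals multiply to
    [1 / N!]. A repeated edge or one outside [E] makes a factor vanish. *)
Lemma trajectory_probE s :
  trajectory_prob R s = if ordering s then (N`!)%:R^-1 else 0.
Proof.
rewrite /trajectory_prob; case: ifP => vs.
  transitivity (\prod_(i < N) ((N - i)%:R^-1 : R)).
    apply: eq_bigr => i _; rewrite /step_prob.
    have [us /allP sE] := andP vs.
    have -> : tnth s i \in E :\: graph_at s i.
      have eE : tnth s i \in E by exact: sE _ (mem_tnth i s).
      rewrite in_setD eE andbT inE.
      rewrite (tnth_nth (tnth s i)) in_take_leq ?size_tuple ?(ltnW (ltn_ord i)) //.
      by rewrite index_uniq ?size_tuple // ltnn.
    rewrite cardsD (setIidPr (graph_at_sub _ vs)) card_graph_at //.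
    exact: ltnW (ltn_ord i).
  by rewrite prodfV -natr_prod -ffact_prod ffactnn.
apply/eqP; rewrite prodf_seq_eq0; apply: contraFT vs => /hasPn h.
have {}h (i : 'I_N) : tnth s i \in E :\: graph_at s i.
  have := h i (mem_index_enum _); rewrite /step_prob /=.
  by case: ifP => //; rewrite eqxx.
apply/andP; split.
  apply: (nth_notin_take_uniq (x0 := set0)) => i; rewrite size_tuple => lti.
  have := h (Ordinal lti); rewrite !inE (tnth_nth set0) /=.
  by case/andP.
apply/allP => e /tnthP[i ->]; have := h i; rewrite in_setD; by case/andP.
Qed.

Lemma sum_trajectory_prob : \sum_(s : N.-tuple {set T}) trajectory_prob R s = 1.
Proof.
under eq_bigr do rewrite trajectory_probE.
rewrite -big_mkcond sumr_const /=.
have -> : #|ordering| = N`!.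
  rewrite -ffactnn -(@card_uniq_tuples _ N (mem E)) cardsE; apply: eq_card => s.
  by rewrite /in_mem /= andbC.
by rewrite -[LHS]mulr_natr mulVf // pnatr_eq0 -lt0n fact_gt0.
Qed.

(** An ordering whose first [m] edges form [K] splits into an ordering of [K] and one of [E :\: K],
    so there are at most [m! (N - m)!] of them among the [N!]. *)
Lemma graph_at_prob K : K \subset E ->
  process_prob R (fun s => graph_at s #|K| == K) <= ('C(N, #|K|))%:R^-1.
Proof.
move=> KE; set m := #|K|; have mN : (m <= N)%N by exact: subset_leq_card.
rewrite /process_prob; under eq_bigr do rewrite trajectory_probE.
rewrite -big_mkcondr sumr_const /=.
(* Defaults for [insubd] only: [take m s] and [drop m s] always have the right lengths. *)
pose t0 : m.-tuple {set T} := nseq_tuple m set0.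
pose t1 : (N - m).-tuple {set T} := nseq_tuple (N - m) set0.
pose f s : m.-tuple {set T} * (N - m).-tuple {set T} :=
  (insubd t0 (take m s), insubd t1 (drop m s)).
have f1 s : val (f s).1 = take m s by rewrite val_insubd size_takel ?size_tuple ?eqxx.
have f2 s : val (f s).2 = drop m s by rewrite val_insubd size_drop size_tuple eqxx.
have finj : injective f.
  by move=> s s' ss'; apply: val_inj; rewrite /= -(cat_take_drop m s) -f1 -f2 ss' f1 f2 cat_take_drop.
pose D := [set s : N.-tuple {set T} | (graph_at s m == K) && ordering s].
have -> : #|(fun s : N.-tuple {set T} => (graph_at s m == K) && ordering s)| = #|D|.
  by rewrite cardsE; apply: eq_card.
have leD : (#|D| <= m`! * (N - m)`!)%N.
  rewrite -(card_imset _ finj).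
  have cEK : #|E :\: K| = (N - m)%N by rewrite cardsD (setIidPr KE).
  pose A1 := [set t : m.-tuple {set T} | all (mem K) t & uniq t].
  pose A2 := [set t : (N - m).-tuple {set T} | all (mem (E :\: K)) t & uniq t].
  have cA1 : #|A1| = m`! by rewrite card_uniq_tuples -/m ffactnn.
  have cA2 : #|A2| = (N - m)`! by rewrite card_uniq_tuples /= cEK ffactnn.
  rewrite -cA1 -cA2 -cardsX; apply: subset_leq_card.
  apply/subsetP => x /imsetP[s]; rewrite inE => /andP[/eqP gK /andP[us /allP sE]] -> {x}.
  rewrite !inE /=; have := us; rewrite -{1}(cat_take_drop m s) cat_uniq.
  case/and3P=> u1 dis u2; rewrite -[insubd t0 _]/((f s).1) -[insubd t1 _]/((f s).2).
  rewrite !f1 !f2 u1 u2 !andbT; apply/andP; split.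
    by apply/allP => e /= es; rewrite -gK inE.
  apply/allP => e /= es; have eE : e \in E by exact: sE _ (mem_drop es).
  rewrite in_setD eE andbT -gK inE.
  by apply: contra dis => et; apply/hasP; exists e.
rewrite -[X in X <= _]mulr_natl; apply: (@le_trans _ _ ((m`! * (N - m)`!)%:R * N`!%:R^-1)).
  by rewrite ler_wpM2r ?invr_ge0 ?ler_nat.
have -> : N`!%:R = 'C(N, m)%:R * (m`! * (N - m)`!)%:R :> R.
  by rewrite -natrM bin_fact.
rewrite invfM mulrCA divff ?mulr1 //.
by rewrite pnatr_eq0 muln_eq0 negb_or -!lt0n !fact_gt0.
Qed.

(** If [A] fails on an ordering, then [G(m)] is bad for every [m]. Hence the failure probability may
    be averaged over a binomially distributed [m], and by [graph_at_prob] this average is bounded by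
    the probability that the Bernoulli subset is bad. *)
Lemma process_transfer (q : R) (good : pred {set {set T}}) (A : pred (N.-tuple {set T})) :
  0 <= q <= 1 ->
  (forall s m, ordering s -> (m <= N)%N -> good (graph_at s m) -> A s) ->
  1 - process_prob R A <= bexp E q (fun K => (~~ good K)%:R).
Proof.
move=> /andP[q0 q1] gA.
have tr0 s : 0 <= trajectory_prob R s.
  by rewrite trajectory_probE; case: ifP => // _; rewrite invr_ge0.
have -> : 1 - process_prob R A = \sum_(s : N.-tuple {set T} | ~~ A s) trajectory_prob R s.
  by rewrite -sum_trajectory_prob (bigID A) /= addrAC subrr add0r.
pose pm (m : 'I_N.+1) : R := 'C(N, m)%:R * ((1 - q) ^+ m * q ^+ (N - m)).
have pm1 : \sum_m pm m = 1.
  have <- : (q + (1 - q)) ^+ N = 1 by rewrite addrC subrK expr1n.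
  rewrite exprDn; apply: eq_bigr => m _.
  by rewrite /pm mulr_natl [_ * q ^+ _]mulrC.
have pm0 m : 0 <= pm m by rewrite !mulr_ge0 // exprn_ge0 //; lra.
rewrite -[X in X <= _]mul1r -[X in X * _ <= _]pm1 mulr_suml.
(* The Bernoulli side is split by size; [inord] loses nothing because subsets of [E] have at most
   [N] elements. *)
rewrite /bexp (partition_big (fun K => inord #|K| : 'I_N.+1) xpredT) //=.
apply: ler_sum => m _; have mN : (m <= N)%N by rewrite -ltnS.
apply: (@le_trans _ _ (pm m * \sum_(K in powerset E | (#|K| == m) && ~~ good K)
    process_prob R (fun s => graph_at s m == K))).
  rewrite ler_wpM2l // /process_prob.
  under [X in _ <= X]eq_bigr do rewrite big_mkcond.
  rewrite exchange_big /= [X in X <= _]big_mkcond; apply: ler_sum => s _.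
  have t00 : 0 <= \sum_(K in powerset E | (#|K| == m) && ~~ good K)
     (if graph_at s m == K then trajectory_prob R s else 0).
    by apply: sumr_ge0 => K _; case: ifP.
  case: ifP => // nA; case: (boolP (ordering s)) => vs; last first.
    by rewrite trajectory_probE (negbTE vs) in t00 *.
  rewrite (bigD1 (graph_at s m)) /=; last first.
    rewrite powersetE graph_at_sub // card_graph_at // eqxx /=.
    by apply: contra nA; apply: gA.
  rewrite eqxx lerDl; apply: sumr_ge0 => K _; by case: ifP.
rewrite mulr_sumr [X in X <= _]big_mkcond [X in _ <= X]big_mkcond /=.
apply: ler_sum => K _; case: (boolP (K \in powerset E)) => //= KE.
rewrite powersetE in KE.
have KN : (#|K| <= N)%N by exact: subset_leq_card.
have -> : (inord #|K| == m) = (#|K| == m :> nat).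
  by rewrite -val_eqE /= inordK.
case: eqP => //= Km; case: (boolP (good K)) => /= gK; first by rewrite mulr0.
rewrite mulr1 bweightE // /pm -Km mulrAC ler_piMl //.
  by rewrite mulr_ge0 // exprn_ge0 //; lra.
rewrite mulrC; apply: le_trans (ler_wpM2r _ (graph_at_prob KE)) _; first by [].
by rewrite mulVf // pnatr_eq0 -lt0n bin_gt0.
Qed.

End Process.

(** * Connectivity and hitting times *)

Local Open Scope nat_scope.

Section Connectivity.
Variable T : finType.
Implicit Types (E K H : {set {set T}}) (S U W : {set T}) (v w x y : T).

Definition nbrs K v : {set T} := [set w | [set v; w] \in K].

Lemma simple_graphS K E : K \subset E -> simple_graph E -> simple_graph K.
Proof. by move=> KE sE e /(subsetP KE)/sE. Qed.

Lemma simple_edge_neq K v w : simple_graph K -> [set v; w] \in K -> v != w.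
Proof. by move=> sK /sK; rewrite cards2; case: eqP. Qed.

Lemma edge_other_end K e v : simple_graph K -> e \in K -> v \in e ->
  exists w, e = [set v; w].
Proof.
move=> sK /sK; rewrite (cardsD1 v) => + ve; rewrite ve add1n => -[] /eqP/cards1P[w ew].
by exists w; rewrite -ew setD1K.
Qed.

Lemma set2_injr v : injective (fun w => [set v; w]).
Proof.
move=> w w' /= h.
have : w \in [set v; w'] by rewrite -h set22.
have : w' \in [set v; w] by rewrite h set22.
rewrite !inE => /orP[/eqP->|/eqP->//] /orP[]/eqP-> //.
Qed.

Lemma degreeE K v : simple_graph K -> degree K v = #|nbrs K v|.
Proof.
move=> sK; rewrite -(card_imset _ (@set2_injr v)); congr #|pred_of_set _|.
apply/setP => e; rewrite inE; apply/andP/imsetP.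
  case=> eK ve; have [w ew] := edge_other_end sK eK ve.
  by exists w => //; rewrite inE -ew.
by case=> w; rewrite inE => wK ->; rewrite wK set21.
Qed.

Lemma degreeS K H v : K \subset H -> degree K v <= degree H v.
Proof.
move=> KH; apply: subset_leq_card; apply/subsetP => e; rewrite !inE.
by case/andP=> /(subsetP KH)-> ->.
Qed.

Lemma min_degree_geS k K H : K \subset H -> min_degree_ge k K -> min_degree_ge k H.
Proof.
move=> KH /forallP h; apply/forallP => v; exact: leq_trans (h v) (degreeS v KH).
Qed.

(** A vertex with fewer than [k] neighbours is cut off by deleting them, and [k < #|T|] leaves some
    other vertex to be separated from. *)
Lemma k_connected_min_degree k K : simple_graph K -> k_connected k K -> min_degree_ge k K.
Proof.
move=> sK /andP[kT /forallP h]; apply/forallP => v; rewrite leqNgt; apply/negP.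
rewrite degreeE // => vk; have := h (nbrs K v); rewrite vk /=.
have vS : v \in ~: nbrs K v.
  by rewrite !inE; apply/negP => /(simple_edge_neq sK); rewrite eqxx.
move=> /forall_inP/(_ v vS)/forall_inP h1.
have : 0 < #|~: (v |: nbrs K v)|.
  have := cardsC (v |: nbrs K v); rewrite cardsU1.
  by move: vS; rewrite inE => ->; lia.
case/card_gt0P=> y; rewrite !inE negb_or => /andP[yv yS].
have : y \in ~: nbrs K v by rewrite !inE.
move/h1 => /connectP[[|w p] /=]; first by move=> _ yv'; rewrite yv' eqxx in yv.
case/andP=> /and3P[_ wS vw] _; by rewrite inE vw in wS.
Qed.

(** The set [U] is the component of [x] in [K - S], where [x] and [y] are not connected there. *)
Lemma not_k_connected_cut k K : k < #|T| -> ~~ k_connected k K ->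
  exists S U, [/\ #|S| < k, U != set0, ~: (U :|: S) != set0, [disjoint U & S] &
    forall x y, x \in U -> y \notin U :|: S -> [set x; y] \notin K].
Proof.
move=> kT; rewrite /k_connected kT /= negb_forall => /existsP[S].
rewrite negb_imply => /andP[Sk]; rewrite negb_forall => /existsP[x].
rewrite negb_imply inE => /andP[xS]; rewrite negb_forall => /existsP[y].
rewrite negb_imply inE => /andP[yS nxy].
have US z : connect (adj_avoiding K S) x z -> z \notin S.
  case/connectP=> p; elim/last_ind: p z => [|p z' _] z /=; first by move=> _ ->.
  by rewrite rcons_path last_rcons => /andP[_ /and3P[_ ? _]] ->.
exists S, [set z | connect (adj_avoiding K S) x z]; split=> //.
- by apply/set0Pn; exists x; rewrite inE connect0.
- by apply/set0Pn; exists y; rewrite !inE negb_or nxy.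
- by rewrite disjoints_subset; apply/subsetP => z; rewrite !inE; apply: US.
- move=> u w; rewrite !inE negb_or => xu /andP[xw wS].
  apply: contra xw => uwK; apply: (connect_trans xu); apply: connect1.
  by apply/and3P; split; [exact: US | exact: wS | exact: uwK].
Qed.

(** A certificate read off from one graph of the process: the minimum degree is still too small, and
    every later graph is [k]-connected as soon as its minimum degree suffices. *)
Definition forces_hitting k E K := ~~ min_degree_ge k K &&
  [forall K' : {set {set T}}, (K \subset K') && (K' \subset E) ==>
     min_degree_ge k K' ==> k_connected k K'].

Lemma graph_atS (s : seq {set T}) i j : i <= j -> graph_at s i \subset graph_at s j.
Proof.
move=> ij; apply/subsetP => e; rewrite !inE => es.
by move: es; rewrite -(take_takel s ij); apply: mem_take.
Qed.

(** The minimum degree reaches [k] only after time [m], so at that moment the graph contains the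
    certificate and is [k]-connected. The other inequality is [k_connected_min_degree]. *)
Lemma hitting_time_eq k E (s : #|E|.-tuple {set T}) m :
  simple_graph E -> min_degree_ge k E -> ordering s -> m <= #|E| ->
  forces_hitting k E (graph_at s m) ->
  hitting_time (min_degree_ge k) s == hitting_time (k_connected k) s.
Proof.
move=> sE dE os mE /andP[nk /forallP fk]; rewrite /hitting_time.
set a := fun i => _; set b := fun i => _; set r := iota 0 _.
have ba : subpred b a.
  move=> i; apply: k_connected_min_degree; apply: simple_graphS sE.
  exact: graph_at_sub.
have ha : has a r.
  apply/hasP; exists #|E|; first by rewrite mem_iota /= add0n.
  suff -> : a #|E| = min_degree_ge k E by [].
  congr (min_degree_ge k _); apply/eqP; rewrite eqEcard graph_at_sub //=.
  by rewrite card_graph_at.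
have lt : find a r < #|E|.+1 by rewrite -[X in _ < X](size_iota 0) -has_find.
have ai : a (find a r) by have := nth_find 0 ha; rewrite nth_iota // add0n.
have bi : b (find a r).
  have := fk (graph_at s (find a r)); rewrite graph_at_sub // andbT.
  rewrite graph_atS; first by move=> /implyP/(_ isT)/implyP/(_ ai).
  rewrite leqNgt; apply: contra nk => /ltnW /(graph_atS s) /min_degree_geS; exact.
rewrite eqn_leq (sub_find ba) andTb leqNgt; apply/negP => h.
by have := before_find 0 h; rewrite nth_iota // add0n bi.
Qed.

End Connectivity.

(** * Breadth-first search codes *)

Section Exploration.
Variables (T : finType) (E : {set {set T}}) (d : nat).
Hypotheses (sE : simple_graph E) (rE : regular d E).
Implicit Types (A H : {set {set T}}) (W X : {set T}) (Q : seq T) (v w r x y : T).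

(** Avoiding the complement of [W] leaves the subgraph induced on [W]. *)
Definition connected_in H W :=
  [forall x in W, forall y in W, connect (adj_avoiding H (~: W)) x y].

Definition nth_nbr v j := nth v (enum (nbrs E v)) j.

(* Breadth-first search driven by a code: a bit tells whether the head of the
   queue has a further child, whose label is then read, or is finished. *)
Fixpoint explore (b : seq bool) (l : seq nat) X Q A : {set T} * {set {set T}} :=
  match b, Q, l with
  | true :: b', v :: _, j :: l' =>
      let w := nth_nbr v j in explore b' l' (w |: X) (rcons Q w) ([set v; w] |: A)
  | false :: b', _ :: Q', _ => explore b' l X Q' A
  | _, _, _ => (X, A)
  end.

Lemma connected_closed_eq H W r X :
  r \in X -> (forall y, y \in W -> connect (adj_avoiding H (~: W)) r y) -> X \subset W ->
  (forall x w, x \in X -> w \in W -> [set x; w] \in H -> w \in X) -> X = W.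
Proof.
move=> rX conn XW clX; apply/eqP; rewrite eqEsubset XW /=.
apply/subsetP => y /conn/connectP[p pp ->] {y}.
elim: p r rX pp {conn} => //= y p IHp x xX /andP[/and3P[_ yW xy] pp].
apply: IHp pp; apply: clX xX _ xy.
by move: yW; rewrite !inE negbK.
Qed.

(** Invariant of the search: [X] is the discovered part of [W], finished vertices have no
    undiscovered [H]-neighbour in [W], and [A] consists of one edge per discovery. The induction is
    on [2 (|W| - |X|) + |Q|], the number of bits still to be read: a discovery and a finished vertex
    each lower it by one. *)
Lemma explore_complete H W r X Q A :
  H \subset E -> r \in X -> (forall y, y \in W -> connect (adj_avoiding H (~: W)) r y) ->
  X \subset W -> {subset Q <= X} ->
  (forall x w, x \in X -> x \notin Q -> w \in W -> [set x; w] \in H -> w \in X) ->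
  A \subset H -> #|A|.+1 = #|X| -> (forall e, e \in A -> e \subset X) ->
  exists b l, [/\ size b = (2 * (#|W| - #|X|) + size Q)%N, size l = (#|W| - #|X|)%N,
    all (gtn d) l & exists A', [/\ explore b l X Q A = (W, A'), A' \subset H,
      #|A'|.+1 = #|W| & forall e, e \in A' -> e \subset W]].
Proof.
move=> HE rX conn; move: {-2}(2 * (#|W| - #|X|) + size Q)%N (erefl (2 * (#|W| - #|X|) + size Q)%N) => n.
elim: n X rX Q A => [|n IH] X rX [|v Q] A /= en XW QX clX AH cA AX; try by rewrite ?addnS in en.
- have XeqW : X = W by apply: connected_closed_eq rX conn XW _ => x w xX; apply: clX.
  subst X; exists [::], [::]; rewrite subnn; split=> //; exists A; split=> //.
- have XeqW : X = W by apply: connected_closed_eq rX conn XW _ => x w xX; apply: clX.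
  by move: en; rewrite XeqW subnn.
have vX : v \in X by apply: QX; rewrite inE eqxx.
(* Either the head of the queue has an undiscovered neighbour in [W], which becomes its child, or it
   is finished. *)
case: (pickP [pred w | [&& w \in W, w \notin X & [set v; w] \in H]]) => [w /and3P[wW wX vw]|none].
  have vwE : w \in nbrs E v by rewrite inE (subsetP HE).
  have ltW : #|X| < #|W|.
    by apply: proper_card; rewrite properE XW /=; apply/subsetPn; exists w.
  have cX : #|w |: X| = #|X|.+1 by rewrite cardsU1 wX.
  have vwA : [set v; w] \notin A.
    by apply: contra wX => /AX/subsetP/(_ w); rewrite set22; apply.
  have [||||||||b [l [sb sl dl hA]]] := IH (w |: X) _ (rcons (v :: Q) w) ([set v; w] |: A).
  + by rewrite !inE rX orbT.
  + by rewrite /= size_rcons cX; move: en ltW; clear; lia.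
  + by rewrite subUset sub1set wW XW.
  + move=> z; rewrite mem_rcons inE => /orP[/eqP->|/QX zX]; first by rewrite !inE eqxx.
    by rewrite !inE zX orbT.
  + move=> x z; rewrite in_setU1 mem_rcons [x \in w :: _]inE negb_or => /orP[/eqP->|xX]; first by rewrite eqxx.
    by case/andP=> _ xQ zW xz; rewrite !inE (clX x z) ?orbT.
  + by rewrite subUset sub1set vw AH.
  + by rewrite cX (cardsU1 [set v; w] A) vwA add1n cA.
  + move=> e; rewrite !inE => /orP[/eqP->|/AX eX].
      by apply/subsetP => z; rewrite !inE => /orP[]/eqP->; rewrite ?vX ?eqxx ?orbT.
    exact: subset_trans eX (subsetUr _ _).
  exists (true :: b), (index w (enum (nbrs E v)) :: l); split => /=.
  + by rewrite sb.
  + by rewrite sl cX; move: ltW; clear; lia.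
  + by rewrite dl andbT -(rE v) degreeE // cardE index_mem mem_enum.
  + by rewrite /nth_nbr nth_index ?mem_enum.
have [||||||||b [l [sb sl dl hA]]] := IH X _ Q A => //.
+ by move: en; clear; lia.
+ by move=> z zQ; apply: QX; rewrite inE zQ orbT.
+ move=> x w xX xQ wW xw; case: (eqVneq x v) => [xv|xv].
    by have := none w; rewrite /= wW -xv xw andbT => /negbT; rewrite negbK.
  by apply: clX xw => //; rewrite inE negb_or xv.
by exists (false :: b), l; split=> //=; rewrite sb.
Qed.

(** Starting from a single root, the potential is [2 |W| - 1]. This leaves at most
    [n 2^(2m-1) d^(m-1)] codes for the connected sets of size [m], each with a set of [m - 1] edges
    that must be present. *)
Lemma connected_code H W : H \subset E -> W != set0 -> connected_in H W ->
  exists r b l, [/\ size b = (2 * #|W|).-1, size l = #|W|.-1,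
    all (gtn d) l & exists A, [/\ explore b l [set r] [:: r] set0 = (W, A), A \subset H,
      #|A|.+1 = #|W| & forall e, e \in A -> e \subset W]].
Proof.
move=> HE /set0Pn[r rW] /forall_inP/(_ r rW)/forall_inP cW.
have [||||||||b [l [sb sl dl hA]]] := @explore_complete H W r [set r] [:: r] set0 HE.
- by rewrite inE.
- exact: cW.
- by rewrite sub1set.
- by move=> x; rewrite !inE.
- by move=> x w; rewrite !inE => ->.
- exact: sub0set.
- by rewrite cards0 cards1.
- by move=> e; rewrite inE.
have W0 : 0 < #|W| by apply/card_gt0P; exists r.
exists r, b, l; split=> //.
- by rewrite sb cards1 /=; move: W0; clear; lia.
- by rewrite sl cards1; move: W0; clear; lia.
Qed.

End Exploration.

Local Open Scope ring_scope.

(** * Small connected sets *)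

Section SmallSets.
Variables (R : realFieldType) (T : finType) (E : {set {set T}}) (d k : nat).
Hypotheses (sE : simple_graph E) (rE : regular d E).
Variables (q x : R).
Hypotheses (q01 : 0 <= q <= 1) (x01 : 0 < x <= 1).
Implicit Types (A H : {set {set T}}) (W X : {set T}).

Definition boundary H W := [set e in H | #|e :&: W| == 1%N].

Lemma boundaryI H W : H \subset E -> boundary E W :&: H = boundary H W.
Proof.
move=> HE; apply/setP => e; rewrite !inE.
by case: (boolP (e \in H)) => [/(subsetP HE)->|]; rewrite ?andbT ?andbF.
Qed.

(** Chernoff's method: since [x <= 1], the indicator of at most [b] boundary edges is at most [x] to
    the power of their number minus [b]. Edges inside [W] are not boundary edges, so [bexp_tree]
    applies. *)
Lemma bexp_tree_boundary A W b : A \subset E -> (forall e, e \in A -> e \subset W) ->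
  bexp E q (fun H => (A \subset H)%:R * (edge_boundary H W <= b)%:R)
  <= (1 - q) ^+ #|A| * (q + (1 - q) * x) ^+ edge_boundary E W * x^-1 ^+ b.
Proof.
move=> AE AW; have /andP[x0 x1] := x01.
have BE : boundary E W \subset E by apply/subsetP => e; rewrite inE => /andP[].
have dAB : [disjoint A & boundary E W].
  rewrite disjoints_subset; apply/subsetP => e eA; rewrite !inE.
  by rewrite (subsetP AE) // (setIidPl (AW _ eA)) (sE (subsetP AE _ eA)).
rewrite -(bexp_tree q x AE BE dAB) mulrC -bexpZ.
apply: ler_bexp => // H HE; rewrite (boundaryI W HE).
rewrite mulrCA ler_wpM2l //; case: leqP => [le|_].
  by rewrite exprVn ler_pdivlMl ?exprn_gt0 // mulr1 ler_wiXn2l // ltW.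
by rewrite mulr_ge0 // exprn_ge0 // ?invr_ge0 ltW.
Qed.

(** This is what a small nontrivial component of [H - S] with [|S| < k] looks like once [S] is
    forgotten, so no union bound over [S] is paid here. *)
Definition small_trap (small : pred nat) H W :=
  [&& (1 < #|W|)%N, small #|W|, connected_in H W & (edge_boundary H W <= k * #|W|)%N].

(** First moment over sizes [m], roots and codes: every trap is the output of some code whose edges
    lie in [H], and each code is charged by [bexp_tree_boundary]. *)
Lemma no_small_trap (small : pred nat) (g : R) : 0 <= g ->
  (forall W, small #|W| -> (q + (1 - q) * x) ^+ edge_boundary E W <= g ^+ #|W|) ->
  bexp E q (fun H => [exists W, small_trap small H W]%:R)
  <= \sum_(m < #|T|.+1 | (1 < m)%N)
       #|T|%:R * (2 ^ (2 * m).-1 * d ^ m.-1)%:R * ((1 - q) ^+ m.-1 * (g * x^-1 ^+ k) ^+ m).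
Proof.
move=> g0 hg; have /andP[q0 q1] := q01; have /andP[x0 x1] := x01.
pose code m : finType := ((2 * m).-1.-tuple bool * m.-1.-tuple 'I_d)%type.
pose dec r m (c : code m) := explore E c.1 (map val c.2) [set r] [:: r] set0.
(* Keeps the codes whose output has the right size and consists of edges of [E] inside the vertex
   set; all others contribute zero. *)
pose ok m (WA : {set T} * {set {set T}}) := [&& #|WA.1| == m, small m, WA.2 \subset E,
  #|WA.2| == m.-1 & [forall e in WA.2, e \subset WA.1]].
pose term m r (c : code m) H : R := (ok m (dec r m c))%:R *
  (((dec r m c).2 \subset H)%:R * (edge_boundary H (dec r m c).1 <= k * m)%:R).
have term0 m r c H : 0 <= term m r c H by rewrite /term !mulr_ge0.
apply: (@le_trans _ _ (bexp E q (fun H =>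
    \sum_(m < #|T|.+1 | (1 < m)%N) \sum_(r : T) \sum_(c : code m) term m r c H))).
  apply: ler_bexp => // H HE; case: existsP => [[W]|_]; last first.
    by rewrite /= !sumr_ge0 // => m _; rewrite !sumr_ge0 // => r _; rewrite sumr_ge0.
  case/and4P=> W1 sW cW bW.
  have W0 : W != set0 by rewrite -card_gt0; apply: ltnW.
  have [r [b [l [sb sl dl [A [eA AH cA AW]]]]]] := connected_code sE rE HE W0 cW.
  have mT : (#|W| < #|T|.+1)%N by rewrite ltnS max_card.
  rewrite (bigD1 (Ordinal mT)) //= (bigD1 r) //=.
  have sb' : size b == (2 * #|W|).-1 by rewrite sb.
  (* All labels are below [d], so [pmap insub] drops none of them. *)
  have [l' el'] : exists l' : #|W|.-1.-tuple 'I_d, map val l' = l.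
    have sl' : size (pmap (insub : nat -> option 'I_d) l) == #|W|.-1.
      by rewrite size_pmap_sub -sl -all_count.
    exists (Tuple sl') => /=; rewrite pmap_filter ?(all_filterP _) //.
      by apply: sub_all dl => j /= jd; rewrite insubT.
    by move=> j; rewrite /= insubK.
  rewrite (bigD1 ((Tuple sb', l') : code #|W|)) //=.
  set rest1 := \sum_(i | _) _; set rest2 := \sum_(i | _) _; set rest3 := \sum_(i | _) _.
  have r1 : 0 <= rest1 by apply: sumr_ge0.
  have r2 : 0 <= rest2 by apply: sumr_ge0 => ? _; apply: sumr_ge0.
  have r3 : 0 <= rest3 by do 2!(apply: sumr_ge0 => ? _); apply: sumr_ge0.
  have -> : term #|W| r (Tuple sb', l') H = 1.
    rewrite /term /dec /= el' eA /ok /= eqxx sW AH bW -cA /= eqxx (subset_trans AH) //.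
    by have -> : [forall e in A, e \subset W] by [apply/forall_inP]; rewrite !mul1r.
  by rewrite -!addrA lerDl !addr_ge0.
rewrite bexp_sum; apply: ler_sum => m m1.
rewrite bexp_sum.
have -> : #|T|%:R * (2 ^ (2 * m).-1 * d ^ m.-1)%:R * ((1 - q) ^+ m.-1 * (g * x^-1 ^+ k) ^+ m)
  = \sum_(r : T) \sum_(c : code m) ((1 - q) ^+ m.-1 * (g * x^-1 ^+ k) ^+ m).
  rewrite !sumr_const card_prod !card_tuple card_bool card_ord.
  by rewrite -mulrA mulr_natl mulr_natl.
apply: ler_sum => r _; rewrite bexp_sum; apply: ler_sum => c _.
rewrite /term bexpZ; case: (boolP (ok _ _)) => [|_]; last first.
  rewrite mul0r !mulr_ge0 // ?exprn_ge0 ?subr_ge0 //.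
  by rewrite mulr_ge0 // exprn_ge0 // invr_ge0 ltW.
case/and5P=> /eqP cW sm AE /eqP cA /forall_inP AW; rewrite mul1r.
apply: le_trans (bexp_tree_boundary _ AE AW) _.
rewrite cA exprMn -exprM -mulrA ler_wpM2l ?exprn_ge0 ?subr_ge0 //.
rewrite ler_wpM2r ?exprn_ge0 ?invr_ge0 ?(ltW x0) //.
by have := hg (dec r m c).1; rewrite cW; apply.
Qed.

(** Each endpoint lies on [d - 1] further edges, and no edge other than [e] contains both
    endpoints. *)
Lemma edge_boundary_edge e : e \in E -> (2 * d.-1 <= edge_boundary E e)%N.
Proof.
move=> eE; have /eqP/cards2P[u [v [uv ee]]] := sE eE.
pose D w := [set f in E | w \in f] :\ e.
have cD w : w \in e -> #|D w| = d.-1.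
  move=> we; have := rE w; rewrite /degree (cardsD1 e) !inE eE we add1n /D => <-.
  by [].
have dis : [disjoint D u & D v].
  rewrite disjoints_subset; apply/subsetP => f; rewrite !inE.
  case/and3P=> fe fE uf; rewrite fe fE /=; apply: contra fe => vf.
  by rewrite eq_sym eqEcard (sE eE) (sE fE) andbT ee subUset !sub1set uf vf.
have <- : #|D u :|: D v| = (2 * d.-1)%N.
  rewrite cardsU; move: dis; rewrite -setI_eq0 => /eqP->.
  by rewrite cards0 subn0 !cD ?ee ?set21 ?set22 // mul2n addnn.
apply: subset_leq_card; apply/subsetP => f fD; rewrite inE.
have [fE fe] : f \in E /\ f != e.
  by move: fD; rewrite !inE => /orP[] /and3P[-> ->].
rewrite fE /=; have lt2 : (#|f :&: e| < 2)%N.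
  rewrite -(sE fE) proper_card // properEneq subsetIl andbT.
  apply: contra fe => /eqP fe; rewrite eqEcard (sE eE) (sE fE) andbT.
  by rewrite -fe subsetIr.
have : (0 < #|f :&: e|)%N.
  apply/card_gt0P; move: fD; rewrite !inE => /orP[] /and3P[_ _ wf].
    by exists u; rewrite inE wf ee set21.
  by exists v; rewrite inE wf ee set22.
by move: lt2; clear; case: #|_| => [|[]].
Qed.

(** If both ends of [e] have degree below [k], then [e], viewed as a vertex set, has at most [2k]
    boundary edges in [H]; so [bexp_tree_boundary] applies with an empty tree. *)
Lemma no_adjacent_low_degree :
  bexp E q (fun H => [exists e in E, [forall v in e, (degree H v < k)%N]]%:R)
  <= #|E|%:R * ((q + (1 - q) * x) ^+ (2 * d.-1) * x^-1 ^+ (2 * k)).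
Proof.
have /andP[q0 q1] := q01; have /andP[x0 x1] := x01.
apply: (@le_trans _ _ (bexp E q (fun H =>
    \sum_(e in E) (edge_boundary H e <= 2 * k)%:R))).
  apply: ler_bexp => // H HE; case: existsP => [[e /andP[eE /forall_inP lo]]|_]; last first.
    by rewrite sumr_ge0.
  rewrite (bigD1 e) //=; have -> : (edge_boundary H e <= 2 * k)%N.
    have /eqP/cards2P[u [v [uv ee]]] := sE eE.
    have lu : (degree H u < k)%N by apply: lo; rewrite ee set21.
    have lv : (degree H v < k)%N by apply: lo; rewrite ee set22.
    have : (edge_boundary H e <= degree H u + degree H v)%N.
      rewrite /degree -cardsUI; apply: leq_trans (leq_addr _ _); apply: subset_leq_card.
      apply/subsetP => f; rewrite !inE => /andP[fH fe]; rewrite fH /=.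
      have : (0 < #|f :&: e|)%N by rewrite (eqP fe).
      by case/card_gt0P => z; rewrite ee !inE => /andP[zf /orP[]/eqP<-]; rewrite zf ?orbT.
    by move: lu lv; clear; lia.
  by rewrite lerDl sumr_ge0.
rewrite bexp_sum mulr_natl -sumr_const; apply: ler_sum => e eE.
have := @bexp_tree_boundary set0 e (2 * k) (sub0set _).
rewrite cards0 expr0 mul1r.
under eq_bexp do rewrite sub0set mul1r.
move=> h; apply: le_trans (h _) _; first by move=> f; rewrite inE.
rewrite ler_wpM2r ?exprn_ge0 ?invr_ge0 ?(ltW x0) //.
rewrite ler_wiXn2l ?edge_boundary_edge //.
  by rewrite addr_ge0 // mulr_ge0 ?subr_ge0 // ltW.
by rewrite -lerBrDl ler_piMr // subr_ge0.
Qed.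

End SmallSets.

(** * Isolated vertices *)

Section SecondMoment.
Variables (R : realFieldType) (T : finType) (E : {set {set T}}) (d : nat).
Hypotheses (sE : simple_graph E) (rE : regular d E) (d0 : (0 < d)%N) (T0 : (0 < #|T|)%N).
Variable q : R.
Hypothesis q01 : 0 < q <= 1.

Definition star v := [set e in E | v \in e].

Lemma starI u v : u != v -> star u :&: star v = [set e in E | e == [set u; v]].
Proof.
move=> uv; apply/setP => e; rewrite !inE; case: (boolP (e \in E)) => //= eE.
apply/andP/eqP => [[ue ve]|->]; last by rewrite set21 set22.
have [w ew] := edge_other_end sE eE ue; move: ve; rewrite ew !inE.
by rewrite eq_sym (negbTE uv) /= => /eqP->.
Qed.

(** Stars of distinct vertices share at most the edge joining them, so their union has [2d] or
    [2d - 1] elements; the three terms cover the generic, equal and adjacent pairs. *)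
Lemma exp_card_stars u v : q ^+ #|star u :|: star v| <=
  q ^+ (2 * d) + (u == v)%:R * q ^+ d + ([set u; v] \in E)%:R * q ^+ (2 * d).-1.
Proof.
have /andP[q0 q1] := q01.
have qn n : 0 <= q ^+ n by rewrite exprn_ge0 // ltW.
have cs w : #|star w| = d by exact: rE.
case: eqVneq => [->|uv].
  by rewrite setUid cs mul1r addrAC lerDr addr_ge0 // mulr_ge0.
rewrite cardsU !cs mul0r addr0 starI // addnn -mul2n.
case: (boolP (_ \in E)) => uvE.
  have -> : [set e in E | e == [set u; v]] = [set [set u; v]].
    by apply/setP => e; rewrite !inE; case: eqP => [->|]; rewrite ?uvE ?andbF.
  by rewrite cards1 subn1 mul1r lerDr.
have -> : [set e in E | e == [set u; v]] = set0.
  by apply/setP => e; rewrite !inE; case: eqP => [->|]; rewrite ?(negbTE uvE) ?andbF.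
by rewrite cards0 subn0 mul0r addr0.
Qed.

(** Chebyshev's inequality for the number [X] of isolated vertices, with mean [mu = n q^d]: if
    [X = 0] then [(X / mu - 1)^2 = 1]. The diagonal of the second moment gives [1 / mu], and
    adjacent pairs give [d / (n q)]. *)
Lemma prob_no_isolated :
  bexp E q (fun H => (min_degree_ge 1 H)%:R)
  <= (#|T|%:R * q ^+ d)^-1 + d%:R / (#|T|%:R * q).
Proof.
have /andP[q0 q1] := q01.
have q01' : 0 <= q <= 1 by rewrite ltW.
pose X (H : {set {set T}}) : R := \sum_v [disjoint star v & H]%:R.
pose mu : R := #|T|%:R * q ^+ d.
have n0 : 0 < #|T|%:R :> R by rewrite ltr0n.
have mu0 : 0 < mu by rewrite mulr_gt0 // exprn_gt0.
have starE v : star v \subset E by apply/subsetP => e; rewrite inE => /andP[].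
have EX : bexp E q X = mu.
  rewrite bexp_sum (eq_bigr (fun=> q ^+ d)) => [|v _]; first by rewrite sumr_const /mu mulr_natl.
  by rewrite bexp_absent // -[#|_|]/(degree E v) rE.
have EX2 : bexp E q (fun H => X H * X H) <=
    mu * mu + mu + #|T|%:R * d%:R * q ^+ (2 * d).-1.
  have -> : bexp E q (fun H => X H * X H) = \sum_u \sum_v q ^+ #|star u :|: star v|.
    rewrite (@eq_bexp _ _ _ q _ (fun H => \sum_u \sum_v [disjoint star u :|: star v & H]%:R)).
      rewrite bexp_sum; apply: eq_bigr => u _; rewrite bexp_sum; apply: eq_bigr => v _.
      by rewrite bexp_absent // subUset !starE.
    move=> H _; rewrite /X big_distrlr; apply: eq_bigr => u _; apply: eq_bigr => v _ /=.
    rewrite -natrM mulnb; congr (_%:R); congr nat_of_bool.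
    by rewrite -!setI_eq0 setIUl setU_eq0.
  apply: (@le_trans _ _ (\sum_(u : T) \sum_(v : T) (q ^+ (2 * d) + (u == v)%:R * q ^+ d
      + ([set u; v] \in E)%:R * q ^+ (2 * d).-1))).
    by apply: ler_sum => u _; apply: ler_sum => v _; apply: exp_card_stars.
  rewrite (eq_bigr (fun=> #|T|%:R * q ^+ (2 * d) + q ^+ d + d%:R * q ^+ (2 * d).-1)); last first.
    move=> u _; rewrite !big_split /= sumr_const mulr_natl; congr (_ + _ + _).
      rewrite (bigD1 u) //= eqxx mul1r big1 ?addr0 // => v.
      by rewrite eq_sym => /negbTE->; rewrite mul0r.
    rewrite -mulr_suml -natr_sum; congr (_%:R * _).
    rewrite -(rE u) degreeE // /nbrs -sum1dep_card [RHS]big_mkcond /=.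
    by apply: eq_bigr => v _; case: ifP.
  rewrite sumr_const -mulr_natl /mu mul2n -addnn exprD -[#|xpredT|]/(#|T|).
  by rewrite le_eqVlt; apply/orP; left; apply/eqP; ring.
apply: (@le_trans _ _ (bexp E q (fun H => mu^-1 * mu^-1 * (X H * X H) + (- 2 * mu^-1 * X H + 1)))).
  apply: ler_bexp => // H HE.
  have -> : mu^-1 * mu^-1 * (X H * X H) + (- 2 * mu^-1 * X H + 1) = (mu^-1 * X H - 1) ^+ 2.
    by ring.
  case: (boolP (min_degree_ge 1 H)) => [/forallP md|_]; last exact: sqr_ge0.
  have -> : X H = 0.
    apply: big1 => v _; have := md v; rewrite /degree => /card_gt0P[e]; rewrite inE => /andP[eH ve].
    case: (boolP [disjoint _ & _]) => // /pred0P/(_ e); rewrite /= eH andbT !inE ve andbT.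
    by rewrite (subsetP HE).
  by rewrite mulr0 sub0r sqrrN expr1n.
rewrite !bexpD !bexpZ bexp_cst EX.
apply: (@le_trans _ _ (mu^-1 * mu^-1 * (mu * mu + mu + #|T|%:R * d%:R * q ^+ (2 * d).-1) + (- 2 * mu^-1 * mu + 1))).
  by rewrite lerD2r ler_wpM2l // mulr_ge0 // invr_ge0 ltW.
rewrite le_eqVlt; apply/orP; left; apply/eqP; rewrite -/mu.
have -> : q ^+ (2 * d).-1 = q ^+ d * q ^+ d / q.
  have -> : (2 * d).-1 = (d + d.-1)%N by move: d0; clear; lia.
  rewrite exprD -mulrA; congr (_ * _).
  by rewrite -[in RHS](prednK d0) exprS mulrC mulKf // gt_eqF.
have mun0 : mu != 0 by rewrite gt_eqF.
have nn0 : #|T|%:R != 0 :> R by rewrite gt_eqF.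
have qn0 : q != 0 by rewrite gt_eqF.
have qd : q ^+ d = mu / #|T|%:R by rewrite /mu mulrAC divff // mul1r.
rewrite qd; move: mu mun0 {EX EX2 mu0 qd} => mu mun0.
by field; rewrite ?mun0 ?nn0 ?qn0.
Qed.

End SecondMoment.

(** * Sprinkling *)

Lemma card_disjoint_bigcup (I F : finType) (J : {set I}) (M : I -> {set F}) :
  (forall u v, u \in J -> v \in J -> u != v -> [disjoint M u & M v]) ->
  #|\bigcup_(v in J) M v| = (\sum_(v in J) #|M v|)%N.
Proof.
move=> dis; pose M' v := if v \in J then M v else set0.
rewrite big_mkcond -sum1_card (@partition_disjoint_bigcup _ _ _ _ _ M') /M' => [|u v uv].
  rewrite [RHS]big_mkcond; apply: eq_bigr => v _; rewrite sum1_card.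
  by case: ifP => // _; rewrite cards0.
have d0 (A B : {set F}) : A == set0 -> [disjoint A & B] by move=> /eqP->; rewrite -setI_eq0 set0I.
case: ifP => uJ; last exact: d0.
by case: ifP => vJ; [apply: dis | rewrite disjoint_sym d0].
Qed.

Lemma bigcupl_disjointP (I F : finType) (J : {set I}) (M : I -> {set F}) (U : {set F}) :
  reflect (forall v, v \in J -> [disjoint M v & U]) [disjoint \bigcup_(v in J) M v & U].
Proof.
rewrite disjoint_sym; apply: (iffP idP) => [/bigcup_disjointP h|h].
  by move=> v vJ; rewrite disjoint_sym h.
by apply/bigcup_disjointP => v vJ; rewrite disjoint_sym h.
Qed.

Section TwoRounds.
Variables (R : realFieldType) (F I : finType) (E : {set F}) (J : {set I}).
Variables (B : {set F}) (M D : I -> {set F}).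
Hypotheses (BE : B \subset E) (ME : forall v, v \in J -> M v \subset E)
  (DE : forall v, v \in J -> D v \subset E)
  (dM : forall u v, u \in J -> v \in J -> u != v -> [disjoint M u & M v])
  (dD : forall u v, u \in J -> v \in J -> u != v -> [disjoint D u & D v])
  (dB : forall v, v \in J -> [disjoint B & M v]).

(** For fixed [H1], the second round must miss [B] and every [M v] whose [D v] meets [H1]; these
    sets are disjoint, so the probability is a product. Averaging over [H1] acts on each [v]
    separately because the [D v] are disjoint. *)
Lemma two_rounds (q1 q2 : R) : 0 <= q1 <= 1 -> 0 <= q2 <= 1 ->
  bexp E q1 (fun H1 => bexp E q2 (fun H2 => ([disjoint B & H2] &&
     [forall v in J, [disjoint D v & H1] || [disjoint M v & H2]])%:R))
  <= q2 ^+ #|B| * \prod_(v in J) (q2 ^+ #|M v| + (1 - q2 ^+ #|M v|) * q1 ^+ #|D v|).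
Proof.
move=> q101 q201.
pose a v := q2 ^+ #|M v|; pose b v := 1 - q2 ^+ #|M v|.
apply: (@le_trans _ _ (bexp E q1 (fun H1 =>
    q2 ^+ #|B| * \prod_(v in J) (b v * [disjoint D v & H1]%:R + a v)))).
  apply: ler_bexp => // H1 H1E.
  (* The indices at which the first round succeeded. *)
  pose J' := [set v in J | ~~ [disjoint D v & H1]].
  have J'J v : v \in J' -> v \in J by rewrite inE => /andP[].
  have -> : q2 ^+ #|B| * \prod_(v in J) (b v * [disjoint D v & H1]%:R + a v)
     = q2 ^+ #|B :|: \bigcup_(v in J') M v|.
    rewrite cardsU.
    have /eqP -> : B :&: \bigcup_(v in J') M v == set0.
      by rewrite setI_eq0; apply/bigcup_disjointP => v /J'J vJ; apply: dB.
    rewrite cards0 subn0 exprD; congr (_ * _).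
    rewrite card_disjoint_bigcup => [|u v /J'J uJ /J'J vJ]; last exact: dM.
    rewrite expr_sum.
    rewrite [RHS](eq_bigl (fun v => (v \in J) && ~~ [disjoint D v & H1])) => [|v]; last by rewrite inE.
    rewrite [RHS]big_mkcondr; apply: eq_bigr => v vJ; rewrite /b /a.
    by case: [disjoint _ & _] => /=; rewrite ?mulr1 ?subrK ?mulr0 ?add0r.
  rewrite -(@bexp_absent R F E q2); last first.
    by rewrite subUset BE; apply/bigcupsP => v /J'J; apply: ME.
  apply: ler_bexp => // H2 H2E; rewrite ler_nat; case: (boolP (_ && _)) => //.
  case/andP=> dBH /forall_inP h; rewrite -setI_eq0 setIUl setU_eq0 setI_eq0 dBH /= setI_eq0.
  rewrite lt0b; apply/bigcupl_disjointP => v; rewrite inE => /andP[vJ nD].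
  by have := h v vJ; rewrite (negbTE nD).
rewrite bexpZ ler_wpM2l ?exprn_ge0 //; first by case/andP: q201.
(* The product is expanded over the set [F0] of indices at which the indicator is chosen; the chosen
   indicators combine to the event that [H1] misses the union of the [D v] over [F0]. *)
rewrite (@eq_bexp _ _ _ q1 _ (fun H1 => \sum_(F0 in powerset J)
    (\prod_(v in J) (if v \in F0 then b v else a v)) * [disjoint \bigcup_(v in F0) D v & H1]%:R)); last first.
  move=> H1 H1E; rewrite -sum_subset_prod; apply: eq_bigr => F0; rewrite powersetE => F0J.
  case: (boolP [disjoint _ & H1]) => [/bigcupl_disjointP h|].
    rewrite mulr1; apply: eq_bigr => v vJ; case: ifP => // vF0.
    by rewrite h // mulr1.
  move=> nd; rewrite mulr0; have [v vF0 nv] : exists2 v, v \in F0 & ~~ [disjoint D v & H1].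
    apply/exists_inP; apply: contraR nd; rewrite negb_exists_in => /forall_inP h.
    by apply/bigcupl_disjointP => v /h; rewrite negbK.
  by rewrite (bigD1 v) ?(subsetP F0J) //= vF0 (negbTE nv) mulr0 mul0r.
rewrite bexp_sum.
have -> : \prod_(v in J) (q2 ^+ #|M v| + (1 - q2 ^+ #|M v|) * q1 ^+ #|D v|)
  = \sum_(F0 in powerset J) \prod_(v in J) (if v \in F0 then b v * q1 ^+ #|D v| else a v).
  by rewrite sum_subset_prod; apply: eq_bigr => v _; rewrite addrC.
apply: ler_sum => F0; rewrite powersetE => F0J.
rewrite bexpZ bexp_absent; last by apply/bigcupsP => v /(subsetP F0J); apply: DE.
rewrite card_disjoint_bigcup => [|u v /(subsetP F0J) uJ /(subsetP F0J) vJ]; last exact: dD.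
rewrite expr_sum.
have -> : \prod_(v in F0) q1 ^+ #|D v| = \prod_(v in J) (if v \in F0 then q1 ^+ #|D v| else 1).
  rewrite -big_mkcondr; apply: eq_bigl => v.
  by rewrite andbC; case: (boolP (v \in F0)) => //= /(subsetP F0J).
rewrite -big_split /= le_eqVlt; apply/orP; left; apply/eqP; apply: eq_bigr => v _.
by case: ifP; rewrite ?mulr1.
Qed.

End TwoRounds.

(** * Edges linking the two sides of a cut *)

Lemma edge_boundaryC (T : finType) (E : {set {set T}}) (U : {set T}) :
  simple_graph E -> edge_boundary E (~: U) = edge_boundary E U.
Proof.
move=> sE; congr #|pred_of_set _|; apply/setP => e; rewrite !inE.
case: (boolP (e \in E)) => //= /sE; rewrite -(cardsID U e) setDE.
by move: #|_ :&: U| #|_ :&: ~: U| => a b; clear; case: a => [|[|[|a]]]; case: b => [|[|[|b]]].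
Qed.

Section Cut.
Variables (T : finType) (E : {set {set T}}) (d k : nat).
Hypotheses (sE : simple_graph E) (rE : regular d E) (kd : (2 * k <= d)%N).
Variables X J S : {set T}.
Hypotheses (dXJ : [disjoint X & J])
  (indJ : forall u v, u \in J -> v \in J -> [set u; v] \notin E) (Sk : (#|S| < k)%N).
Implicit Types (u v : T) (Z P : {set T}) (e : {set T}).

Let Y := ~: (X :|: J :|: S).

Definition edges_to v Z : {set {set T}} := [set [set v; z] | z in nbrs E v :&: Z].

Definition minor v :=
  if (#|edges_to v X| <= #|edges_to v Y|)%N then edges_to v X else edges_to v Y.

Definition major v :=
  if (#|edges_to v X| <= #|edges_to v Y|)%N then edges_to v Y else edges_to v X.

Definition crossing := [set e in E | (e :&: X != set0) && (e :&: Y != set0)].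

Definition link_edges := (#|crossing| + \sum_(v in J) #|minor v|)%N.

(** If [H1] contained a major edge at [v] and [H2] a minor one, then [v] would join [X] to [Y].
    Requiring the plentiful major edges from a separate round leaves the minor edge as the real
    obstacle. *)
Definition unlinked (H1 H2 : {set {set T}}) := [disjoint crossing & H2] &&
  [forall v in J, [disjoint major v & H1] || [disjoint minor v & H2]].

Lemma edges_toP v Z e :
  reflect (exists z, [/\ z \in Z, e = [set v; z] & e \in E]) (e \in edges_to v Z).
Proof.
apply: (iffP imsetP) => [[z]|[z [zZ ->]] eE].
  by rewrite !inE => /andP[eE zZ] ->; exists z.
by exists z => //; rewrite !inE eE zZ.
Qed.

Lemma edges_to_sub v Z : edges_to v Z \subset E.
Proof. by apply/subsetP => e /edges_toP[z []]. Qed.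

Lemma card_edges_to v Z : #|edges_to v Z| = #|nbrs E v :&: Z|.
Proof. exact: card_imset (@set2_injr _ v). Qed.

Lemma edges_to_disjoint u v Z Z' : u != v -> v \notin Z -> u \notin Z' ->
  [disjoint edges_to u Z & edges_to v Z'].
Proof.
move=> uv vZ uZ; rewrite disjoints_subset; apply/subsetP => e /edges_toP[z [zZ ee eE]].
rewrite inE; apply/edges_toP => -[z' [zZ' ee' _]].
have : v \in [set u; z] by rewrite -ee ee' set21.
rewrite !inE eq_sym (negbTE uv) /= => /eqP vz; by rewrite vz zZ in vZ.
Qed.

Lemma notin_X_of_J v : v \in J -> v \notin X.
Proof. by move=> vJ; apply/negP => vX; rewrite (disjointFr dXJ vX) in vJ. Qed.

Lemma notin_Y_of_J v : v \in J -> v \notin Y.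
Proof. by move=> vJ; rewrite !inE vJ orbT. Qed.

Lemma minorE v : minor v = edges_to v X \/ minor v = edges_to v Y.
Proof. by rewrite /minor; case: ifP; [left|right]. Qed.

Lemma majorE v : major v = edges_to v X \/ major v = edges_to v Y.
Proof. by rewrite /major; case: ifP; [right|left]. Qed.

Lemma minor_disjoint u v : u \in J -> v \in J -> u != v -> [disjoint minor u & minor v].
Proof.
move=> uJ vJ uv.
by case: (minorE u) => ->; case: (minorE v) => ->;
  apply: edges_to_disjoint; rewrite ?notin_X_of_J ?notin_Y_of_J.
Qed.

Lemma major_disjoint u v : u \in J -> v \in J -> u != v -> [disjoint major u & major v].
Proof.
move=> uJ vJ uv.
by case: (majorE u) => ->; case: (majorE v) => ->;
  apply: edges_to_disjoint; rewrite ?notin_X_of_J ?notin_Y_of_J.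
Qed.

Lemma crossing_minor_disjoint v : v \in J -> [disjoint crossing & minor v].
Proof.
move=> vJ; rewrite disjoint_sym disjoints_subset; apply/subsetP => e em.
have [z ez] : exists z, e = [set v; z].
  by case: (minorE v) em => -> /edges_toP[z [_ -> _]]; exists z.
rewrite !inE; apply/negP => /and3P[eE /set0Pn[x] + /set0Pn[y]].
rewrite ez 2!in_setI !in_set2 => /andP[xe xX] /andP[ye yY].
have xv : x != v by apply: contraTneq xX => ->; apply: notin_X_of_J.
have yv : y != v by apply: contraTneq yY => ->; apply: notin_Y_of_J.
move: xe ye; rewrite (negbTE xv) (negbTE yv) /= => /eqP xz /eqP yz.
by move: yY; rewrite yz -xz !inE xX.
Qed.

Lemma card_minor v : (#|minor v| <= d)%N.
Proof.
have le Z : (#|edges_to v Z| <= d)%N.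
  rewrite card_edges_to -(rE v) degreeE //; apply: subset_leq_card; exact: subsetIl.
by case: (minorE v) => ->.
Qed.

(** As [J] is independent, the neighbours of [v] lie in [X], [Y] or [S]. Fewer than [k <= d / 2] are
    in [S], so the larger side receives at least a quarter of them. *)
Lemma card_major v : v \in J -> (d <= 4 * #|major v|)%N.
Proof.
move=> vJ; have dle : (d <= #|edges_to v X| + #|edges_to v Y| + #|S|)%N.
  rewrite !card_edges_to -(rE v) degreeE //.
  apply: (@leq_trans #|(nbrs E v :&: X) :|: (nbrs E v :&: Y) :|: S|).
    apply: subset_leq_card; apply/subsetP => w wv; rewrite !inE; move: (wv); rewrite inE => -> /=.
    have : w \notin J by apply/negP => wJ; move: wv; rewrite inE; apply/negP/indJ.
    by move/negbTE=> ->; case: (w \in X); case: (w \in S).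
  by apply: leq_trans (leq_card_setU _ _) _; rewrite leq_add2r leq_card_setU.
move: dle Sk kd; rewrite /major; case: ifP; move: #|edges_to v X| #|edges_to v Y| #|S|; clear; lia.
Qed.

(** Add to [X] the vertices of [J] whose majority side is [X]. A boundary edge of the resulting set
    is crossing, is a minor edge, or meets [S]; at most [k d] edges do the last. *)
Lemma boundary_link_edges : exists P : {set T}, [/\ X \subset P, Y \subset ~: P &
  (edge_boundary E P <= link_edges + k * d)%N].
Proof.
pose P := X :|: [set v in J | ~~ (#|edges_to v X| <= #|edges_to v Y|)%N].
exists P; split; first exact: subsetUl.
  by apply/subsetP => y; rewrite !inE => /norP[/norP[/negbTE-> /negbTE->] _].
apply: (@leq_trans #|crossing :|: \bigcup_(v in J) minor v :|: \bigcup_(s in S) star E s|).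
  apply: subset_leq_card; apply/subsetP => e; rewrite inE => /andP[eE /cards1P[a eP]].
  have [ae aP] : a \in e /\ a \in P.
    by have : a \in e :&: P; [rewrite eP set11 | rewrite inE => /andP[]].
  have [b eb] := edge_other_end sE eE ae.
  have ab : a != b by apply: (simple_edge_neq sE); rewrite -eb.
  have bP : b \notin P.
    apply: contra ab => bP; have : b \in e :&: P by rewrite inE bP eb set22.
    by rewrite eP inE eq_sym.
  rewrite !in_setU.
  have [aS|aS] := boolP (a \in S).
    by apply/orP; right; apply/bigcupP; exists a; rewrite // inE eE.
  have [bS|bS] := boolP (b \in S).
    by apply/orP; right; apply/bigcupP; exists b; rewrite // inE eE eb set22.
  apply/orP; left.
  move: bP; rewrite !inE negb_or negb_and negbK => /andP[bX bJ].
  have [bJ'|bJ'] := boolP (b \in J).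
    rewrite bJ' /= in bJ.
    move: aP; rewrite !inE => /orP[aX|/andP[aJ _]]; last first.
      by have := indJ aJ bJ'; rewrite -eb eE.
    apply/orP; right; apply/bigcupP; exists b => //; rewrite /minor bJ.
    by apply/edges_toP; exists a; split; rewrite // eb setUC.
  have bY : b \in Y by rewrite !inE (negbTE bX) (negbTE bJ') (negbTE bS).
  move: aP; rewrite !inE => /orP[aX|/andP[aJ aXY]]; apply/orP.
    left; rewrite eE; apply/andP; split=> //; apply/andP; split; apply/set0Pn.
      by exists a; rewrite inE ae.
    by exists b; rewrite inE eb set22.
  right; apply/bigcupP; exists a => //; rewrite /minor (negbTE aXY).
  by apply/edges_toP; exists b; split.
apply: leq_trans (leq_card_setU _ _) _; apply: leq_add.
  apply: leq_trans (leq_card_setU _ _) _; rewrite leq_add2l.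
  by rewrite card_disjoint_bigcup //; apply: minor_disjoint.
apply: leq_trans (_ : (\sum_(s in S) d <= _)%N); last first.
  by rewrite sum_nat_const leq_mul2r ltnW ?orbT.
apply: (big_ind2 (fun (A : {set {set T}}) n => #|A| <= n)%N); first by rewrite cards0.
  by move=> A m B n Am Bn; apply: leq_trans (leq_card_setU _ _) (leq_add Am Bn).
by move=> s _; rewrite -[#|_|]/(degree E s) rE.
Qed.

Variable R : realFieldType.

(** Expansion is applied to [P] or to its complement, whichever has at most half of the vertices.
    Both have at least [|X|] elements, since the complement contains [Y]. *)
Lemma link_edges_ge (c : R) : 0 <= c ->
  (forall U : {set T}, #|U|%:R <= #|T|%:R / 2 :> R -> c * #|U|%:R <= (edge_boundary E U)%:R) ->
  (#|X| <= #|Y|)%N -> c * #|X|%:R <= (link_edges + k * d)%:R.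
Proof.
move=> c0 hexp XY; have [P [XP YP le]] := boundary_link_edges.
have XP' := subset_leq_card XP; have YP' := subset_leq_card YP.
have two0 : (0 : R) < 2 by [].
case: (leqP (2 * #|P|) #|T|) => h.
  apply: (@le_trans _ _ (edge_boundary E P)%:R); last by rewrite ler_nat.
  apply: (@le_trans _ _ (c * #|P|%:R)); first by rewrite ler_wpM2l // ler_nat.
  by apply: hexp; rewrite ler_pdivlMr // -natrM ler_nat mulnC.
apply: (@le_trans _ _ (edge_boundary E (~: P))%:R); last by rewrite edge_boundaryC // ler_nat.
apply: (@le_trans _ _ (c * #|~: P|%:R)).
  by rewrite ler_wpM2l // ler_nat (leq_trans XY).
apply: hexp; rewrite ler_pdivlMr // -natrM ler_nat.
by have := cardsC P; move: h; clear; lia.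
Qed.

(** The base [z] makes all link edges count alike: a crossing edge costs [q2 <= z], and a vertex of
    [J] with [t] minor edges costs at most [z ^+ t]. *)
Lemma prob_unlinked (q1 q2 z : R) : 0 <= q1 <= 1 -> 0 <= q2 <= 1 -> q2 <= z ->
  (forall t m, (t <= d)%N -> (d <= 4 * m)%N ->
     q2 ^+ t + (1 - q2 ^+ t) * q1 ^+ m <= z ^+ t) ->
  bexp E q1 (fun H1 => bexp E q2 (fun H2 => (unlinked H1 H2)%:R)) <= z ^+ link_edges.
Proof.
move=> q101 q201 q2z hz.
have /andP[q10 q11] := q101; have /andP[q20 q21] := q201.
have mE v : minor v \subset E by case: (minorE v) => ->; apply: edges_to_sub.
have ME v : major v \subset E by case: (majorE v) => ->; apply: edges_to_sub.
apply: le_trans (two_rounds (J := J) _ _ _ _ _ _ q101 q201) _ => //.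
- by apply/subsetP => e; rewrite inE => /andP[].
- exact: minor_disjoint.
- exact: major_disjoint.
- exact: crossing_minor_disjoint.
rewrite /link_edges exprD; apply: ler_pM; rewrite ?exprn_ge0 //.
- apply: prodr_ge0 => v _; rewrite addr_ge0 ?exprn_ge0 // mulr_ge0 ?exprn_ge0 //.
  by rewrite subr_ge0 exprn_ile1.
- by rewrite lerXn2r // nnegrE // (le_trans q20).
rewrite expr_sum; apply: ler_prod => v vJ; rewrite hz ?card_minor ?card_major // andbT.
rewrite addr_ge0 ?exprn_ge0 // mulr_ge0 ?exprn_ge0 //.
by rewrite subr_ge0 exprn_ile1.
Qed.

End Cut.

(** * Components after deleting a small set *)

Lemma edge_sym (T : finType) (x y : T) : [set x; y] = [set y; x].
Proof. exact: setUC. Qed.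

Lemma adj_avoiding_sym (T : finType) (H : {set {set T}}) S : symmetric (adj_avoiding H S).
Proof.
move=> x y; rewrite /adj_avoiding /= [in RHS]edge_sym.
by case: (x \in S); case: (y \in S).
Qed.

Lemma connect_avoiding_sym (T : finType) (H : {set {set T}}) S :
  connect_sym (adj_avoiding H S).
Proof. exact: sym_connect_sym (@adj_avoiding_sym T H S). Qed.

Section Components.
Variables (T : finType) (E H : {set {set T}}) (S : {set T}) (k : nat).
Hypotheses (sE : simple_graph E) (HE : H \subset E) (Sk : (#|S| < k)%N).
Local Notation rS := (adj_avoiding H S).
Implicit Types (x y v w : T) (U X Rt : {set T}).

(** The isolated vertices of [H - S]. *)
Definition stranded : {set T} := [set v | (v \notin S) && [forall w, ~~ rS v w]].

Definition component x : {set T} := [set y | connect rS x y].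

(** A union of nontrivial components of [H - S], encoded by their canonical roots so that the union
    bound runs over sets of components rather than sets of vertices. *)
Definition joined Rt : {set T} :=
  [set x | [&& x \notin S, x \notin stranded & fingraph.root rS x \in Rt]].

Lemma component_avoids x y : x \notin S -> y \in component x -> y \notin S.
Proof.
move=> xS; rewrite inE => /connectP[p]; elim/last_ind: p y => [|p z' _] z /=; first by move=> _ ->.
by rewrite rcons_path last_rcons => /andP[_ /and3P[_ ? _]] ->.
Qed.

Lemma component_connected x : x \notin S -> connected_in H (component x).
Proof.
move=> xS; apply/forall_inP => u ux; apply/forall_inP => v vx.
have : connect rS u v.
  move: ux vx; rewrite !inE => ux vx; apply: connect_trans vx.
  by rewrite connect_avoiding_sym.
case/connectP=> p; elim: p u ux => [|w p IH] u ux /=; first by move=> _ ->.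
case/andP=> /and3P[uS wS uw] pp lv.
have wx : w \in component x.
  by move: ux; rewrite !inE => /connect_trans; apply; apply: connect1; apply/and3P.
apply: connect_trans (IH w wx pp lv); apply: connect1; apply/and3P.
by split; rewrite // in_setC negbK.
Qed.

(** Every edge of [H] leaving a component of [H - S] ends in [S], so there are at most [|S| |C|] of
    them. *)
Lemma component_boundary x : x \notin S ->
  (edge_boundary H (component x) <= k * #|component x|)%N.
Proof.
move=> xS; set C := component x.
apply: (@leq_trans #|[set [set p.1; p.2] | p in setX S C]|); last first.
  by apply: leq_trans (leq_imset_card _ _) _; rewrite cardsX leq_mul2r (ltnW Sk) orbT.
apply: subset_leq_card; apply/subsetP => e; rewrite inE => /andP[eH /cards1P[a ea]].
have [ae aC] : a \in e /\ a \in C.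
  by have : a \in e :&: C; [rewrite ea set11 | rewrite inE => /andP[]].
have sH := simple_graphS HE sE.
have [b eb] := edge_other_end sH eH ae.
have ab : a != b by apply: (simple_edge_neq sH); rewrite -eb.
have bC : b \notin C.
  apply: contra ab => bC; have : b \in e :&: C by rewrite inE bC eb set22.
  by rewrite ea inE eq_sym.
have bS : b \in S.
  apply: contraR bC => bS; have aS := component_avoids xS aC.
  move: aC; rewrite !inE => /connect_trans; apply; apply: connect1; apply/and3P.
  by split; rewrite -?eb.
by apply/imsetP; exists (b, a); rewrite ?in_setX ?bS // edge_sym.
Qed.

Lemma card_component_gt1 x : x \notin S -> x \notin stranded -> (1 < #|component x|)%N.
Proof.
move=> xS; rewrite inE xS /= negb_forall => /existsP[w]; rewrite negbK => xw.
have xw' : x != w by case/and3P: xw => _ _; apply: simple_edge_neq; apply: simple_graphS sE.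
have -> : 2%N = #|[set x; w]| by rewrite cards2 xw'.
apply: subset_leq_card; apply/subsetP => y; rewrite !inE => /orP[]/eqP->.
  exact: connect0.
exact: connect1.
Qed.

Lemma component_not_small (small : pred nat) x :
  ~~ [exists W, small_trap k small H W] -> x \notin S -> x \notin stranded ->
  ~~ small #|component x|.
Proof.
rewrite negb_exists => /forallP h xS xI; apply: contra (h (component x)) => sm.
by rewrite /small_trap card_component_gt1 // sm component_connected // component_boundary.
Qed.

Lemma stranded_nbrs v : v \in stranded -> nbrs H v \subset S.
Proof.
rewrite inE => /andP[vS /forallP h]; apply/subsetP => w; rewrite inE => vw.
by apply: contraR (h w) => wS; apply/and3P.
Qed.

Lemma stranded_low_degree v : v \in stranded -> (degree H v < k)%N.
Proof.
move=> /stranded_nbrs vS; rewrite degreeE; last exact: simple_graphS sE.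
exact: leq_ltn_trans (subset_leq_card vS) Sk.
Qed.

Hypothesis no_low : ~~ [exists e in E, [forall v in e, (degree H v < k)%N]].

Lemma stranded_independent u v : u \in stranded -> v \in stranded -> [set u; v] \notin E.
Proof.
move=> us vs; apply: contra no_low => uvE; apply/exists_inP; exists [set u; v] => //.
by apply/forall_inP => w; rewrite !inE => /orP[]/eqP->; apply: stranded_low_degree.
Qed.

Variables (R : realFieldType) (small : pred nat) (L : R).
Hypotheses (smallL : forall m, ~~ small m -> L <= m%:R)
  (no_trap : ~~ [exists W, small_trap k small H W]).

(** [U] is a union of components of [H - S]. Those that are not stranded have at least [L] vertices,
    as there is no trap, and summing over the roots bounds their number. *)
Lemma card_joined U : (forall x y, x \in U -> rS x y -> y \in U) -> [disjoint U & S] ->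
  let X := U :\: stranded in let Rt := [set fingraph.root rS x | x in X] in
  joined Rt = X /\ L * #|Rt|%:R <= #|X|%:R.
Proof.
move=> clU dUS X Rt.
have clC x y : x \in U -> connect rS x y -> y \in U.
  move=> + /connectP[p]; elim: p x => [|z p IH] x xU /=; first by move=> _ ->.
  by case/andP=> xz pp ly; apply: IH pp ly; apply: clU xz.
have XS x : x \in X -> x \notin S.
  by rewrite inE => /andP[_ xU]; rewrite (disjointFr dUS xU).
have eX : joined Rt = X.
  apply/setP => x; rewrite inE; apply/and3P/idP => [[xS xI /imsetP[y yX ry]]|xX].
    rewrite inE xI /=; apply: (clC y); first by move: yX; rewrite inE => /andP[].
    by rewrite connect_avoiding_sym; apply/(fingraph.rootP (@connect_avoiding_sym T H S)).
  by split; [exact: XS | move: xX; rewrite inE => /andP[] | apply: imset_f].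
split=> //; rewrite -[in X in _ <= X]sum1_card (partition_big (fingraph.root rS) (mem Rt)) /=; last first.
  by move=> x xX; apply: imset_f.
rewrite natr_sum mulr_natr -sumr_const; apply: ler_sum => r /imsetP[x xX ->].
apply: (@le_trans _ _ #|component x|%:R).
  apply: smallL; apply: component_not_small => //; first exact: XS.
  by move: xX; rewrite inE => /andP[].
rewrite ler_nat sum1dep_card; apply: subset_leq_card; apply/subsetP => y yx.
have cxy : connect rS x y by move: yx; rewrite inE.
rewrite inE; apply/andP; split; last first.
  by apply/eqP; apply/(fingraph.rootP (@connect_avoiding_sym T H S)); rewrite connect_avoiding_sym.
have [xI xU] : x \notin stranded /\ x \in U by move: xX; rewrite inE => /andP[].
rewrite inE (clC x y) // andbT; apply/negP; rewrite inE => /andP[yS /forallP h].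
move: cxy; rewrite connect_avoiding_sym => /connectP[[|w p] /=].
  by move=> _ yx'; move: xI; rewrite yx' inE yS; case/negP; apply/forallP.
by case/andP=> yw; have := h w; rewrite yw.
Qed.

Definition bad_cut Rt H1 H2 := let X := joined Rt in
  [&& Rt != set0, L * #|Rt|%:R <= #|X|%:R, (#|X| <= #|~: (X :|: stranded :|: S)|)%N &
      unlinked E X stranded S H1 H2].

(** A separation of [K - S] respects the components of [H - S], so [U] without its stranded vertices
    has the form [joined Rt]. Any link would be a connection in [K] between [U] and [V]. *)
Lemma cut_bad_cut (K H1 H2 : {set {set T}}) (U V : {set T}) :
  H \subset K -> H1 \subset K -> H2 \subset K -> K \subset E ->
  min_degree_ge k K ->
  [disjoint U & S] -> [disjoint V & S] -> [disjoint U & V] -> U :|: V :|: S = setT ->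
  U != set0 -> (forall x y, x \in U -> y \in V -> [set x; y] \notin K) ->
  (#|U :\: stranded| <= #|V :\: stranded|)%N ->
  exists Rt, bad_cut Rt H1 H2.
Proof.
move=> HK H1K H2K KE /forallP dK dUS dVS dUV UVS U0 noK leUV.
have inUVS x : [|| x \in U, x \in V | x \in S] by have := in_setT x; rewrite -UVS !inE orbA.
have clU x y : x \in U -> rS x y -> y \in U.
  move=> xU /and3P[xS yS xy]; have := inUVS y; rewrite (negbTE yS) orbF => /orP[//|yV].
  by have := noK x y xU yV; rewrite (subsetP HK).
have [eX leX] := card_joined clU dUS.
set X := U :\: stranded in eX leX; set Rt := [set fingraph.root rS x | x in X] in eX leX.
(* Otherwise [U] is entirely stranded. A vertex of [U] has at least [k] neighbours in [K], hence one
   outside [S]; that one lies in [U] too, giving two adjacent stranded vertices. *)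
have X0 : X != set0.
  apply/negP => X0; case/set0Pn: U0 => u uU.
  have us : u \in stranded.
    by apply: contraLR X0 => us; apply/set0Pn; exists u; rewrite inE us.
  have [w uw wS] : exists2 w, [set u; w] \in K & w \notin S.
    have := dK u; rewrite degreeE; last exact: simple_graphS sE.
    move=> kn; have : ~~ (nbrs K u \subset S).
      by apply: contraL kn => /subset_leq_card le; rewrite -ltnNge (leq_ltn_trans le).
    by case/subsetPn=> w; rewrite inE => ? ?; exists w.
  have := inUVS w; rewrite (negbTE wS) orbF => /orP[wU|wV]; last first.
    by have := noK u w uU wV; rewrite uw.
  have ws : w \in stranded.
    by apply: contraLR X0 => ws; apply/set0Pn; exists w; rewrite inE ws.
  by have := stranded_independent us ws; rewrite (subsetP KE).
have Rt0 : Rt != set0.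
  by case/set0Pn: X0 => x xX; apply/set0Pn; exists (fingraph.root rS x); apply: imset_f.
exists Rt; rewrite /bad_cut eX Rt0 leX /=.
have XU x : x \in X -> x \in U by rewrite inE => /andP[].
have eY : ~: (X :|: stranded :|: S) = V :\: stranded.
  apply/setP => y; rewrite !inE; have := inUVS y.
  case: (boolP (y \in V)) => yV.
    by rewrite (disjointFl dUV yV) (disjointFr dVS yV) !andbF !andbT /= orbF.
  by rewrite orFb => /orP[] ->; rewrite ?orbT ?andbT ?andbF //; case: (_ && _).
rewrite eY leUV /=.
have YV y : y \in ~: (X :|: stranded :|: S) -> y \in V by rewrite eY inE => /andP[].
apply/andP; split.
  rewrite disjoints_subset; apply/subsetP => e; rewrite inE => /and3P[eE /set0Pn[x] + /set0Pn[y]].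
  rewrite 2!in_setI => /andP[xe xX] /andP[ye yY]; rewrite in_setC; apply/negP => eH2.
  have [w ew] := edge_other_end sE eE xe.
  have yw : y = w.
    move: ye; rewrite ew !inE => /orP[]/eqP // yx.
    by have := XU x xX; rewrite -yx (disjointFl dUV (YV y yY)).
  by have := noK x y (XU x xX) (YV y yY); rewrite yw -ew (subsetP H2K).
apply/forall_inP => v vs; apply/negPn; rewrite negb_or; apply/negP => /andP[].
have vS : v \notin S by move: vs; rewrite inE => /andP[].
(* An edge of [K] to [X] forces [v] into [U], and an edge to the other class forces it into [V];
   having both is impossible. *)
have toU (Hx : {set {set T}}) : Hx \subset K -> ~~ [disjoint edges_to E v X & Hx] -> v \in U.
  move=> HxK /pred0Pn[e /andP[/edges_toP[z [zX ez _]] eH]].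
  have := inUVS v; rewrite (negbTE vS) orbF => /orP[//|vV].
  by have := noK z v (XU z zX) vV; rewrite edge_sym -ez (subsetP HxK).
have toV (Hx : {set {set T}}) : Hx \subset K ->
    ~~ [disjoint edges_to E v (~: (X :|: stranded :|: S)) & Hx] -> v \in V.
  move=> HxK /pred0Pn[e /andP[/edges_toP[z [zY ez _]] eH]].
  have := inUVS v; rewrite (negbTE vS) orbF => /orP[vU|//].
  by have := noK v z vU (YV z zY); rewrite -ez (subsetP HxK).
have no : v \in U -> v \in V -> False by move=> vU; rewrite (disjointFr dUV vU).
rewrite /major /minor; case: ifP => _ h1 h2.
  by apply: no; [apply: toU h2 | apply: toV h1].
by apply: no; [apply: toU h1 | apply: toV h2].
Qed.

End Components.

(** * The union bound over all ways to fail *)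

Lemma sum_set_exp (R : realFieldType) (T : finType) (w : R) :
  \sum_(A : {set T}) w ^+ #|A| = (1 + w) ^+ #|T|.
Proof.
rewrite addrC -cardsT -prodr_const -sum_subset_prod.
rewrite [RHS](eq_bigl xpredT) => [|A]; last by rewrite powersetE subsetT.
by apply: eq_bigr => A _; rewrite prod_cond_expr // subsetT.
Qed.

Section Combine.
Variables (R : realFieldType) (T : finType) (E : {set {set T}}) (d k : nat).
Hypotheses (sE : simple_graph E) (rE : regular d E) (k0 : (0 < k)%N)
  (kT : (k < #|T|)%N) (kd : (2 * k <= d)%N).
Variables (q0 q1 q2 x g z w c L : R) (small : pred nat).
Hypotheses (q001 : 0 < q0 <= 1) (q101 : 0 < q1 <= 1) (q201 : 0 < q2 <= 1)
  (x01 : 0 < x <= 1) (g0 : 0 <= g) (c0 : 0 <= c) (w0 : 0 <= w) (q2z : q2 <= z).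
Hypothesis hg : forall W : {set T}, small #|W| ->
  (q0 + (1 - q0) * x) ^+ edge_boundary E W <= g ^+ #|W|.
Hypothesis hz : forall t m, (t <= d)%N -> (d <= 4 * m)%N ->
  q2 ^+ t + (1 - q2 ^+ t) * q1 ^+ m <= z ^+ t.
Hypothesis hexp : forall U : {set T}, #|U|%:R <= #|T|%:R / 2 :> R ->
  c * #|U|%:R <= (edge_boundary E U)%:R.
Hypothesis smallL : forall m, ~~ small m -> L <= m%:R.
(** Converts the number of link edges into a factor [w] per component, the quantity summed over
    [Rt]. *)
Hypothesis hw : forall t r, (0 < r)%N -> c * (L * r%:R) <= (t + k * d)%:R -> z ^+ t <= w ^+ r.

Definition trap (H : {set {set T}}) := [exists W, small_trap k small H W].
Definition low_pair (H : {set {set T}}) := [exists e in E, [forall v in e, (degree H v < k)%N]].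
Definition some_bad_cut H H1 H2 :=
  [exists S : {set T}, (#|S| < k)%N && [exists Rt, bad_cut E H S L Rt H1 H2]].

(** Since [k > 0], an isolated vertex rules out minimum degree [k]. The conjunct [~~ low_pair H0] is
    kept because, for fixed [H0], it makes the stranded vertices independent when the bad cuts are
    counted. *)
Lemma not_forcing (H0 H1 H2 : {set {set T}}) : H0 \subset E -> H1 \subset E -> H2 \subset E ->
  ~~ forces_hitting k E (H0 :|: (H1 :|: H2)) ->
  [|| min_degree_ge 1 (H0 :|: (H1 :|: H2)), trap H0, low_pair H0 |
      ~~ low_pair H0 && some_bad_cut H0 H1 H2].
Proof.
move=> H0E H1E H2E; set G := H0 :|: (H1 :|: H2).
rewrite /forces_hitting negb_and negbK => /orP[md|].
  apply/orP; left; apply/forallP => v; have /forallP/(_ v) := md; exact: leq_trans.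
rewrite negb_forall => /existsP[K hK]; rewrite !negb_imply in hK.
have /andP[/andP[GK KE] /andP[dK nK]] := hK.
have [tr|tr] := boolP (trap H0); first by apply/or4P; constructor 2.
have [lp|lp] := boolP (low_pair H0); first by apply/or4P; constructor 3.
apply/or4P; constructor 4; rewrite andTb.
have [S [U [Sk U0 V0 dUS noK]]] := not_k_connected_cut kT nK.
apply/existsP; exists S; rewrite Sk /=.
have H0K : H0 \subset K by apply: subset_trans GK; apply: subsetUl.
have HH : H1 :|: H2 \subset K by apply: subset_trans GK; apply: subsetUr.
have H1K : H1 \subset K by apply: subset_trans HH; apply: subsetUl.
have H2K : H2 \subset K by apply: subset_trans HH; apply: subsetUr.
pose V := ~: (U :|: S).
have dVS : [disjoint V & S].
  by rewrite disjoints_subset; apply/subsetP => v; rewrite !inE negb_or => /andP[].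
have dUV : [disjoint U & V].
  by rewrite disjoints_subset; apply/subsetP => v vU; rewrite !inE vU.
have UVS : U :|: V :|: S = setT.
  by apply/setP => v; rewrite !inE; case: (v \in U); case: (v \in S).
have noK' x' y' : x' \in U -> y' \in V -> [set x'; y'] \notin K.
  by move=> xU; rewrite inE; apply: noK.
apply/existsP.
(* The side with fewer vertices that are not stranded plays the part of [U]. *)
case: (leqP #|U :\: stranded H0 S| #|V :\: stranded H0 S|) => [le|/ltnW le].
  exact: (cut_bad_cut sE H0E Sk lp smallL tr H0K H1K H2K KE dK dUS dVS dUV UVS U0 noK' le).
apply: (cut_bad_cut sE H0E Sk lp smallL tr H0K H1K H2K KE dK dVS dUS _ _ V0 _ le).
- by rewrite disjoint_sym.
- by rewrite -UVS [V :|: U]setUC.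
- by move=> y' x' yV xU; rewrite edge_sym noK'.
Qed.

Lemma lt0_le1W (q : R) : 0 < q <= 1 -> 0 <= q <= 1.
Proof. by case/andP=> /ltW-> ->. Qed.

(** With [H] fixed, each pair of [S] and nonempty [Rt] has probability at most [w ^+ #|Rt|], and
    these powers sum to [(1 + w)^n - 1]. *)
Lemma prob_some_bad_cut (H : {set {set T}}) : H \subset E -> ~~ low_pair H ->
  bexp E q1 (fun H1 => bexp E q2 (fun H2 => (some_bad_cut H H1 H2)%:R))
  <= #|[set S : {set T} | (#|S| < k)%N]|%:R * ((1 + w) ^+ #|T| - 1).
Proof.
move=> HE lp; have q1' := lt0_le1W q101; have q2' := lt0_le1W q201.
apply: (@le_trans _ _ (bexp E q1 (fun H1 => bexp E q2 (fun H2 =>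
   \sum_(S : {set T} | (#|S| < k)%N) \sum_(Rt : {set T} | Rt != set0) (bad_cut E H S L Rt H1 H2)%:R)))).
  apply: ler_bexp => // H1 _; apply: ler_bexp => // H2 _.
  rewrite /some_bad_cut; case: existsP => [[S /andP[Sk /existsP[Rt bc]]]|_]; last first.
    by apply: sumr_ge0 => S _; apply: sumr_ge0.
  have Rt0 : Rt != set0 by case/and4P: bc.
  rewrite (bigD1 S) //= (bigD1 Rt) //= bc -addrA lerDl addr_ge0 //; first exact: sumr_ge0.
  by apply: sumr_ge0 => ? _; apply: sumr_ge0.
have -> : #|[set S : {set T} | (#|S| < k)%N]|%:R * ((1 + w) ^+ #|T| - 1)
  = \sum_(S : {set T} | (#|S| < k)%N) \sum_(Rt : {set T} | Rt != set0) w ^+ #|Rt|.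
  have -> : \sum_(Rt : {set T} | Rt != set0) w ^+ #|Rt| = (1 + w) ^+ #|T| - 1.
    by rewrite -sum_set_exp [in RHS](bigD1 set0) //= cards0 expr0 addrAC subrr add0r.
  by rewrite mulr_natl sumr_const cardsE.
under eq_bexp => H1 _.
  rewrite bexp_sum; under eq_bigr do rewrite bexp_sum. over.
rewrite bexp_sum; apply: ler_sum => S Sk; rewrite bexp_sum; apply: ler_sum => Rt Rt0.
set X := joined H S Rt; set J := stranded H S.
(* The size conditions depend on [H] alone; if they fail, the event is empty. *)
case: (boolP [&& L * #|Rt|%:R <= #|X|%:R & (#|X| <= #|~: (X :|: J :|: S)|)%N]) => [/andP[lX XY]|nX]; last first.
  rewrite (@eq_bexp _ _ _ q1 _ (fun=> 0)) ?bexp_cst ?exprn_ge0 // => H1 _.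
  rewrite (@eq_bexp _ _ _ q2 _ (fun=> 0)) ?bexp_cst // => H2 _.
  rewrite /bad_cut -/X -/J Rt0 /=; apply/eqP; rewrite pnatr_eq0 eqb0.
  by apply: contra nX => /and3P[-> -> _].
apply: (@le_trans _ _ (bexp E q1 (fun H1 => bexp E q2 (fun H2 => (unlinked E X J S H1 H2)%:R)))).
  apply: ler_bexp => // H1 _; apply: ler_bexp => // H2 _; rewrite ler_nat.
  by rewrite /bad_cut -/X -/J; case: unlinked; rewrite ?andbF // leq_b1.
have dXJ : [disjoint X & J].
  by rewrite disjoints_subset; apply/subsetP => v; rewrite [v \in ~: _]inE inE => /and3P[].
have indJ u v : u \in J -> v \in J -> [set u; v] \notin E by exact: (stranded_independent sE HE Sk lp).
apply: le_trans (prob_unlinked sE rE kd dXJ indJ Sk q1' q2' q2z hz) _.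
apply: hw; first by rewrite card_gt0.
apply: le_trans (link_edges_ge sE rE dXJ indJ Sk c0 hexp XY).
by rewrite ler_wpM2l.
Qed.

(** One Bernoulli subset is split into three rounds by [bexp_union]. The first two terms bound the
    absence of isolated vertices; the others bound traps in [H0], adjacent vertices of low degree in
    [H0], and bad cuts. *)
Lemma hitting_prob_bound :
  1 - process_prob R (fun s : #|E|.-tuple {set T} =>
    hitting_time (min_degree_ge k) s == hitting_time (k_connected k) s) <=
  (#|T|%:R * (q0 * (q1 * q2)) ^+ d)^-1 + d%:R / (#|T|%:R * (q0 * (q1 * q2)))
  + \sum_(m < #|T|.+1 | (1 < m)%N)
       #|T|%:R * (2 ^ (2 * m).-1 * d ^ m.-1)%:R * ((1 - q0) ^+ m.-1 * (g * x^-1 ^+ k) ^+ m)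
  + #|E|%:R * ((q0 + (1 - q0) * x) ^+ (2 * d.-1) * x^-1 ^+ (2 * k))
  + #|[set S : {set T} | (#|S| < k)%N]|%:R * ((1 + w) ^+ #|T| - 1).
Proof.
have q0' := lt0_le1W q001; have q1' := lt0_le1W q101; have q2' := lt0_le1W q201.
have [/andP[q00 q01] /andP[q10 q11] /andP[q20 q21]] := And3 q001 q101 q201.
have d0 : (0 < d)%N by move: k0 kd; clear; lia.
have T0 : (0 < #|T|)%N by apply: leq_ltn_trans kT.
have q120 : 0 < q1 * q2 by rewrite mulr_gt0.
have q121 : q1 * q2 <= 1 by rewrite mulr_ile1 // ltW.
have Q01 : 0 < q0 * (q1 * q2) <= 1 by rewrite mulr_gt0 //= mulr_ile1 // ltW.
have w1 : 1 <= (1 + w) ^+ #|T| by rewrite exprn_ege1 // lerDl.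
apply: le_trans (process_transfer (good := forces_hitting k E) (lt0_le1W Q01) _) _.
  move=> s m os mE; apply: hitting_time_eq => //.
  by apply/forallP => v; rewrite rE (leq_trans _ kd) // mul2n -addnn leq_addl.
set bcb := _ * (_ - 1).
have bcb0 : 0 <= bcb by rewrite mulr_ge0 // subr_ge0.
rewrite -bexp_union; under eq_bexp do rewrite -bexp_union.
apply: (@le_trans _ _ (bexp E q0 (fun H0 =>
   bexp E q1 (fun H1 => bexp E q2 (fun H2 => (min_degree_ge 1 (H0 :|: (H1 :|: H2)))%:R))
   + (trap H0)%:R + (low_pair H0)%:R + bcb))).
  apply: ler_bexp => // H0 H0E.
  apply: (@le_trans _ _ (bexp E q1 (fun H1 => bexp E q2 (fun H2 =>
     (min_degree_ge 1 (H0 :|: (H1 :|: H2)))%:R + (trap H0)%:R + (low_pair H0)%:R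
     + (~~ low_pair H0)%:R * (some_bad_cut H0 H1 H2)%:R)))).
    apply: ler_bexp => // H1 H1E; apply: ler_bexp => // H2 H2E.
    have := not_forcing H0E H1E H2E; case: forces_hitting => /=.
      by move=> _; rewrite !addr_ge0 // mulr_ge0.
    move=> /(_ isT); rewrite -natrM mulnb -!natrD ler_nat.
    by case: min_degree_ge; case: trap; case: low_pair; case: some_bad_cut.
  under eq_bexp => H1 _ do rewrite !bexpD !bexp_cst bexpZ.
  rewrite !bexpD !bexp_cst bexpZ lerD2l.
  case: (boolP (low_pair H0)) => lp; rewrite ?mul0r // mul1r.
  exact: prob_some_bad_cut.
rewrite !bexpD bexp_cst lerD2r; apply: lerD; first apply: lerD.
- under eq_bexp do rewrite (@bexp_union _ _ E q1 q2 (fun H' => (min_degree_ge 1 (_ :|: H'))%:R)).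
  rewrite (@bexp_union _ _ E q0 (q1 * q2) (fun H' => (min_degree_ge 1 H')%:R)).
  exact: prob_no_isolated.
- exact: no_small_trap.
- exact: no_adjacent_low_degree.
Qed.

End Combine.

From mathcomp Require Import all_classical all_reals all_analysis.
Import numFieldNormedType.Exports.

(** * Asymptotics *)

Lemma card_bigcup_le (I F : finType) (J : {set I}) (M : I -> {set F}) d :
  (forall v, #|M v| <= d)%N -> (#|\bigcup_(v in J) M v| <= d * #|J|)%N.
Proof.
move=> le; rewrite mulnC -sum_nat_const.
apply: (big_ind2 (fun (A : {set F}) n => #|A| <= n)%N); first by rewrite cards0.
  by move=> A m B n Am Bn; apply: leq_trans (leq_card_setU _ _) (leq_add Am Bn).
by move=> v _.
Qed.

Lemma edge_boundary_le (T : finType) (E : {set {set T}}) d (W : {set T}) :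
  regular d E -> (edge_boundary E W <= d * #|W|)%N.
Proof.
move=> rE; apply: (@leq_trans #|\bigcup_(v in W) star E v|); last first.
  by apply: card_bigcup_le => v; rewrite -[#|_|]/(degree E v) rE.
apply: subset_leq_card; apply/fintype.subsetP => e; rewrite inE => /andP[eE /cards1P[v ev]].
have : v \in e :&: W by rewrite ev set11.
by rewrite inE => /andP[ve vW]; apply/finset.bigcupP; exists v => //; rewrite inE eE.
Qed.

Lemma card_edges_le (T : finType) (E : {set {set T}}) d :
  simple_graph E -> regular d E -> (#|E| <= #|T| * d)%N.
Proof.
move=> sE rE; rewrite mulnC -cardsT.
apply: (@leq_trans #|\bigcup_(v in [set: T]) star E v|); last first.
  by apply: card_bigcup_le => v; rewrite -[#|_|]/(degree E v) rE.
apply: subset_leq_card; apply/fintype.subsetP => e eE.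
have /card_gt0P[v ve] : (0 < #|e|)%N by rewrite (sE e eE).
by apply/finset.bigcupP; exists v; rewrite ?inE // eE.
Qed.

(** * Elementary bounds over the reals *)

Section RealBounds.
Variable R : realType.
Implicit Types x y u : R.

Lemma expR1_ge2 : 2 <= expR 1 :> R.
Proof. by have := expR_ge1Dx (1 : R); lra. Qed.

Lemma expRN1_le : expR (- 1) <= 1 / 2 :> R.
Proof. by rewrite expRN -div1r ler_pM2l // lef_pV2 ?posrE ?expR_gt0 // expR1_ge2. Qed.

Lemma expRN_le u : 0 <= u <= 1 -> expR (- u) <= 1 - u / 2.
Proof.
case/andP=> u0 u1; have h := expR_ge1Dx u.
have p : 0 < 1 + u by lra.
rewrite expRN; apply: (@le_trans _ _ (1 + u)^-1).
  by rewrite lef_pV2 ?posrE ?expR_gt0.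
rewrite -div1r ler_pdivrMr //; nra.
Qed.

Lemma expR_le_lin u : 0 <= u <= 1 / 2 -> expR u <= 1 + 2 * u.
Proof.
case/andP=> u0 u1; have h := expR_ge1Dx (- u).
have p : 0 < 1 - u by lra.
rewrite -[expR u]invrK -expRN; apply: (@le_trans _ _ (1 - u)^-1).
  by rewrite lef_pV2 ?posrE ?expR_gt0.
rewrite -div1r ler_pdivrMr //; nra.
Qed.

(** The exponential is the power [j + 1] of [expR (delta * y / (j + 1))], hence at least
    [s * y ^+ j.+1]; the additional factor [y] beats [K / s]. *)
Lemma expR_dominates (K delta : R) (j : nat) : 0 < delta ->
  exists y0, 1 <= y0 /\ forall y, y0 <= y -> K * y ^+ j <= expR (delta * y).
Proof.
move=> d0; pose s := (delta / j.+1%:R) ^+ j.+1.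
have s0 : 0 < s by rewrite exprn_gt0 // divr_gt0.
exists (1 + `|K| / s); split; first by rewrite lerDl divr_ge0 // ltW.
move=> y hy; have Ks : `|K| / s <= y by apply: le_trans hy; rewrite lerDr.
have y1 : 1 <= y by apply: le_trans hy; rewrite lerDl divr_ge0 // ltW.
have y0 : 0 <= y by apply: le_trans y1.
apply: (@le_trans _ _ (s * y ^+ j.+1)).
  rewrite exprS mulrA ler_wpM2r ?exprn_ge0 //.
  by rewrite (le_trans (ler_norm K)) // -ler_pdivrMl // mulrC.
have -> : delta * y = j.+1%:R * (delta / j.+1%:R * y).
  by rewrite mulrA mulrCA divff ?mulr1 // pnatr_eq0.
rewrite expRM_natl /s -exprMn lerXn2r ?nnegrE ?expR_ge0 //.
  by rewrite mulr_ge0 // divr_ge0 // ltW.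
by apply: le_trans (expR_ge1Dx _); rewrite lerDr.
Qed.

Lemma sum_geometric_le (r : R) (N : nat) : 0 <= r <= 1 / 2 ->
  \sum_(m < N | (1 < m)%N) r ^+ m <= 2 * r ^+ 2.
Proof.
case/andP=> r0 r1.
have main M : \sum_(m < M) r ^+ m <= 2.
  suff : (1 - r) * \sum_(m < M) r ^+ m <= 1.
    have : 0 <= \sum_(m < M) r ^+ m by apply: sumr_ge0 => m _; rewrite exprn_ge0.
    set S := \sum_(m < M) _; nra.
  rewrite -opprB mulNr -subrX1 opprB gerBl exprn_ge0 //.
case: N => [|[|N]]; try by rewrite ?big_ord_recl !big_ord0 /= ?addr0 mulr_ge0 // exprn_ge0.
  by rewrite big_mkcond big_ord_recl big_ord0 /= addr0 mulr_ge0 // exprn_ge0.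
rewrite big_mkcond !big_ord_recl /= !add0r.
rewrite (eq_bigr (fun m : 'I_N => r ^+ 2 * r ^+ m)) => [|m _].
  by rewrite -mulr_sumr mulrC ler_wpM2r ?main ?exprn_ge0.
by rewrite /bump /= !add1n -exprD.
Qed.

(** Each counted set has weight [n^(k - |S|) >= 1], and over all sets the weights sum to
    [n^k (1 + 1/n)^n]. *)
Lemma card_small_sets (T : finType) (k : nat) : (0 < #|T|)%N ->
  #|[set S : {set T} | (#|S| < k)%N]|%:R <= expR 1 * #|T|%:R ^+ k :> R.
Proof.
move=> T0; set n : R := #|T|%:R; have n0 : 0 < n by rewrite ltr0n.
have n1 : 1 <= n by rewrite ler1n.
apply: (@le_trans _ _ (\sum_(S : {set T}) n ^+ k * n^-1 ^+ #|S|)); last first.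
  rewrite -mulr_sumr sum_set_exp mulrC ler_wpM2r ?exprn_ge0 // ?(ltW n0) //.
  have -> : expR 1 = expR n^-1 ^+ #|T| :> R by rewrite -expRM_natl -/n divff ?gt_eqF.
  by rewrite lerXn2r ?nnegrE ?expR_ge0 ?expR_ge1Dx // addr_ge0 // invr_ge0 ltW.
rewrite -sum1_card natr_sum [X in X <= _]big_mkcond /=; apply: ler_sum => S _.
have p0 : 0 <= n ^+ k * n^-1 ^+ #|S| by rewrite mulr_ge0 // exprn_ge0 // ?invr_ge0 ltW.
case: ifP => //; rewrite inE => /ltnW Sk.
by rewrite exprVn ler_pdivlMr ?exprn_gt0 // mul1r ler_weXn2l.
Qed.

End RealBounds.

(** * Estimates of the error terms *)

Section Estimates.
Variables (R : realType) (d k : nat) (y b v : R).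
Hypotheses (dv : d%:R * v = 1) (v0 : 0 < v) (y1 : 1 <= y) (b0 : 0 < b) (b1 : b <= 1 / 2)
  (kv : (k%:R + 1) * v <= b / 200).

(** In the application [y] is the logarithm of [n] and [v = 1/d], so [q0] is [n^(-(1-b/4)/d)]. The
    tilt [x = q0 / y] is small enough to raise [q0] by a factor of at most [expR v], while
    [x^-1 ^+ k] stays near a power of [y]. The base [g] is the resulting boundary cost per
    vertex. *)
Let s := (1 - b / 4) * y * v.
Let q0 := expR (- s).
Let x := q0 / y.
Let g := expR (1 - (1 - b / 4) * (19 / 20) * y).

Lemma y_gt0 : 0 < y. Proof. by apply: lt_le_trans y1. Qed.

Lemma s_ge0 : 0 <= s.
Proof. by rewrite !mulr_ge0 // ?(ltW y_gt0) ?(ltW v0) //; move: b1 b0; lra. Qed.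

Lemma s_le : s <= y * v.
Proof.
rewrite /s -mulrA ler_piMl ?mulr_ge0 ?(ltW y_gt0) ?(ltW v0) //.
by move: b0; lra.
Qed.

Lemma ds : d%:R * s = (1 - b / 4) * y.
Proof. by rewrite /s mulrCA dv mulr1. Qed.

Lemma k1s_le : (k%:R + 1) * s <= b / 200 * y.
Proof.
apply: (@le_trans _ _ ((k%:R + 1) * (y * v))).
  by rewrite ler_wpM2l ?s_le // addr_ge0.
by rewrite mulrCA mulrC ler_wpM2r // (ltW y_gt0).
Qed.

Lemma q0_bounds : 0 < q0 <= 1.
Proof. by rewrite expR_gt0 /= expR_le1 oppr_le0 s_ge0. Qed.

Lemma one_sub_q0 : 1 - q0 <= s.
Proof. by have := expR_ge1Dx (- s); rewrite /q0; lra. Qed.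

Lemma x_bounds : 0 < x <= 1.
Proof.
have /andP[q00 q01] := q0_bounds.
rewrite divr_gt0 ?y_gt0 //= ler_pdivrMr ?y_gt0 // mul1r; exact: le_trans y1.
Qed.

Lemma mix_le : 0 <= q0 + (1 - q0) * x <= expR (v - s).
Proof.
have /andP[q00 q01] := q0_bounds; have /andP[x0 x1] := x_bounds.
apply/andP; split.
  apply: addr_ge0; first exact: ltW.
  by apply: mulr_ge0; [rewrite subr_ge0 | exact: ltW].
have -> : q0 + (1 - q0) * x = q0 * (1 + (1 - q0) / y) by rewrite /x; ring.
rewrite [v - s]addrC expRD -/q0 ler_wpM2l ?(ltW q00) //.
apply: le_trans (expR_ge1Dx v); rewrite lerD2l ler_pdivrMr ?y_gt0 //.
by rewrite mulrC; apply: le_trans one_sub_q0 s_le.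
Qed.

Lemma x_inv : x^-1 = y * expR s.
Proof. by rewrite /x /q0 expRN invf_div invrK. Qed.

Lemma x_invX m : x^-1 ^+ m = y ^+ m * expR (m%:R * s).
Proof. by rewrite x_inv exprMn expRM_natl. Qed.

(** The upper bound on [B] gives [B v <= m], the summand 1 in [g]; the lower bound makes [B s] at
    least [19/20 (1 - b/4) y m]. *)
Lemma mix_expr_le (m B : nat) : (B <= d * m)%N -> 19 / 20 * d%:R * m%:R <= B%:R :> R ->
  (q0 + (1 - q0) * x) ^+ B <= g ^+ m.
Proof.
move=> Bm mB; have /andP[m0 mle] := mix_le.
apply: (@le_trans _ _ (expR (v - s) ^+ B)).
  by rewrite lerXn2r ?nnegrE // expR_ge0.
rewrite /g -!expRM_natl ler_expR.
have h1 : B%:R * v <= m%:R.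
  have -> : m%:R = (d * m)%:R * v by rewrite natrM mulrAC dv mul1r.
  by rewrite ler_wpM2r ?(ltW v0) // ler_nat.
have h2 : 19 / 20 * ((1 - b / 4) * y) * m%:R <= B%:R * s.
  by rewrite -ds; have := ler_wpM2r s_ge0 mB; apply: le_trans; rewrite le_eqVlt; apply/orP; left; apply/eqP; ring.
rewrite mulrBr; move: h1 h2; move: (B%:R * s) (B%:R * v) => Bs Bv h1 h2; lra.
Qed.

Lemma d_one_sub_q0 : d%:R * (1 - q0) <= y.
Proof.
apply: (@le_trans _ _ (d%:R * s)); first by rewrite ler_wpM2l // one_sub_q0.
by rewrite ds ler_piMl ?(ltW y_gt0) //; move: b0; lra.
Qed.

(** Each vertex contributes at most [r]: 4 for its two bits, [y] for a label together with the
    presence of a tree edge, and the boundary cost. As [r <= expR (- (3/4 y))] and the series starts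
    at [m = 2], it beats [n = expR y]. *)
Lemma trap_sum_le (n : nat) : 2 <= y -> n%:R = expR y :> R ->
  4 * expR 1 * y ^+ k.+1 <= expR (1 / 100 * y) ->
  \sum_(m < n.+1 | (1 < m)%N)
       n%:R * (2 ^ (2 * m).-1 * d ^ m.-1)%:R * ((1 - q0) ^+ m.-1 * (g * x^-1 ^+ k) ^+ m)
  <= 2 * expR (- (1 / 2 * y)).
Proof.
move=> y2 ny hgr; have /andP[q00 q01] := q0_bounds; have /andP[x0 x1] := x_bounds.
pose r := 4 * y * (g * x^-1 ^+ k).
have gx0 : 0 <= g * x^-1 ^+ k by rewrite mulr_ge0 ?expR_ge0 // exprn_ge0 // invr_ge0 ltW.
have rle : r <= expR (- (3 / 4 * y)).
  have -> : r = (4 * expR 1 * y ^+ k.+1) * expR (k%:R * s - (1 - b / 4) * (19 / 20) * y).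
    rewrite /r /g x_invX !expRD exprS.
    by ring.
  apply: (@le_trans _ _ (expR (1 / 100 * y) * expR (k%:R * s - (1 - b / 4) * (19 / 20) * y))).
    by rewrite ler_wpM2r ?expR_ge0.
  rewrite -expRD ler_expR.
  have := k1s_le; have := s_ge0; rewrite mulrDl mul1r; move: (k%:R * s) => ks.
  have [hy hb0 hb1] := And3 y1 b0 b1; move=> s0 h.
  have : b * y <= 1 / 2 * y by rewrite ler_wpM2r //; lra.
  by lra.
have r0 : 0 <= r by rewrite mulr_ge0 // mulr_ge0 // (ltW y_gt0).
have r12 : r <= 1 / 2.
  by apply: le_trans rle _; apply: le_trans (expRN1_le R); rewrite ler_expR; lra.
apply: (@le_trans _ _ (\sum_(m < n.+1 | (1 < m)%N) n%:R * r ^+ m)).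
  apply: ler_sum => m m1; rewrite -mulrA ler_wpM2l // /r; move: gx0.
  move: (g * x^-1 ^+ k) => G gx0.
  have -> : (2 ^ (2 * m).-1 * d ^ m.-1)%:R * ((1 - q0) ^+ m.-1 * G ^+ m)
    = 2 ^+ (2 * m).-1 * (d%:R * (1 - q0)) ^+ m.-1 * G ^+ m.
    by rewrite natrM !natrX exprMn; ring.
  rewrite [(4 * y * G) ^+ m]exprMn; apply: ler_wpM2r; first exact: exprn_ge0.
  rewrite [(4 * y) ^+ m]exprMn; apply: ler_pM; rewrite ?exprn_ge0 ?mulr_ge0 ?subr_ge0 //.
    have -> : (4 : R) = 2 ^+ 2 by ring.
    by rewrite -exprM ler_weXn2l ?ler1n // leq_pred.
  apply: (@le_trans _ _ (y ^+ m.-1)).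
    by rewrite lerXn2r ?nnegrE ?mulr_ge0 ?subr_ge0 ?(ltW y_gt0) // d_one_sub_q0.
  by rewrite ler_weXn2l // leq_pred.
rewrite -mulr_sumr.
apply: (@le_trans _ _ (n%:R * (2 * r ^+ 2))).
  by rewrite ler_wpM2l // sum_geometric_le // r0.
apply: (@le_trans _ _ (expR y * (2 * expR (- (3 / 4 * y)) ^+ 2))).
  by rewrite ny ler_wpM2l ?expR_ge0 // ler_wpM2l // lerXn2r ?nnegrE ?expR_ge0.
by rewrite -expRM_natl mulrCA -expRD ler_wpM2l // ler_expR; move: y1; lra.
Qed.

(** There are at most [expR ((2 - b) y)] edges, each bad with probability about
    [expR (- (2 - b/2) y)]. Half of the surplus [b/2] in the exponent absorbs the lower-order
    terms. *)
Lemma low_pair_le (n M : nat) : (0 < d)%N -> n%:R = expR y :> R ->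
  (M <= n * d)%N -> d%:R <= expR ((1 - b) * y) ->
  expR 2 * y ^+ (2 * k) <= expR (b / 8 * y) ->
  M%:R * ((q0 + (1 - q0) * x) ^+ (2 * d.-1) * x^-1 ^+ (2 * k)) <= expR (- (b / 4 * y)).
Proof.
move=> d0 ny Mnd dle hgr; have /andP[q00 q01] := q0_bounds; have /andP[x0 x1] := x_bounds.
have /andP[m0 mle] := mix_le.
apply: (@le_trans _ _ (expR y * expR ((1 - b) * y) *
    (expR (v - s) ^+ (2 * d.-1) * (y ^+ (2 * k) * expR ((2 * k)%:R * s))))).
  apply: ler_pM; rewrite ?mulr_ge0 ?exprn_ge0 ?invr_ge0 ?(ltW x0) //.
    apply: (@le_trans _ _ (n * d)%:R); first by rewrite ler_nat.
    by rewrite natrM ny ler_wpM2l ?expR_ge0.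
  rewrite x_invX ler_wpM2r ?mulr_ge0 ?expR_ge0 ?exprn_ge0 ?(ltW y_gt0) //.
  by rewrite lerXn2r ?nnegrE ?expR_ge0.
have e1 : expR (v - s) ^+ (2 * d.-1) <= expR 2 * expR (2 * s - 2 * ((1 - b / 4) * y)).
  rewrite -expRM_natl -expRD ler_expR -ds.
  have -> : (2 * d.-1)%:R = 2 * (d%:R - 1) :> R by rewrite natrM -subn1 natrB.
  have -> : 2 * (d%:R - 1) * (v - s) = 2 * (d%:R * v) - 2 * v + 2 * s - 2 * (d%:R * s) :> R by ring.
  by rewrite dv; move: v0; move: (d%:R * s); move=> *; lra.
apply: (@le_trans _ _ (expR y * expR ((1 - b) * y) *
   (expR 2 * expR (2 * s - 2 * ((1 - b / 4) * y)) * (y ^+ (2 * k) * expR ((2 * k)%:R * s))))).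
  rewrite ler_wpM2l ?mulr_ge0 ?expR_ge0 // ler_wpM2r // mulr_ge0 ?expR_ge0 // exprn_ge0 //.
  exact: ltW y_gt0.
have -> : expR y * expR ((1 - b) * y) *
   (expR 2 * expR (2 * s - 2 * ((1 - b / 4) * y)) * (y ^+ (2 * k) * expR ((2 * k)%:R * s)))
  = (expR 2 * y ^+ (2 * k)) * (expR y * expR ((1 - b) * y) *
   expR (2 * s - 2 * ((1 - b / 4) * y)) * expR ((2 * k)%:R * s)) by ring.
rewrite -!expRD.
apply: (@le_trans _ _ (expR (b / 8 * y) * expR (y + (1 - b) * y + (2 * s - 2 * ((1 - b / 4) * y)) + (2 * k)%:R * s))).
  by rewrite ler_wpM2r ?expR_ge0.
rewrite -expRD ler_expR.
have -> : (2 * k)%:R * s = 2 * (k%:R * s) by rewrite natrM mulrA.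
have := k1s_le; have := y_gt0; rewrite mulrDl mul1r; move: (k%:R * s) => ks.
have hb0 := b0; move=> y0 h.
have : 0 < b * y by rewrite mulr_gt0.
by lra.
Qed.

(** The mean number of isolated vertices is [expR (b/4 y - 5)], where 5 is the total cost of the two
    sprinkling rounds; the adjacent pairs are controlled by [d <= n^(1-b)]. *)
Lemma no_isolated_le (n : nat) : (0 < d)%N -> n%:R = expR y :> R ->
  d%:R <= expR ((1 - b) * y) ->
  (n%:R * (q0 * (expR (- (4 * v)) * expR (- v))) ^+ d)^-1
    + d%:R / (n%:R * (q0 * (expR (- (4 * v)) * expR (- v))))
  <= 2 * expR 5 * expR (- (b / 4 * y)).
Proof.
move=> d0 ny dle; set Q := q0 * _.
have -> : Q = expR (- s - 5 * v).
  by rewrite /Q /q0 -!expRD; congr expR; ring.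
have v1 : v <= 1.
  rewrite -[X in _ <= X]dv ler_peMl ?(ltW v0) // ler1n //.
have e1 : (n%:R * expR (- s - 5 * v) ^+ d)^-1 <= expR 5 * expR (- (b / 4 * y)).
  rewrite ny -expRM_natl -expRD -expRN -expRD ler_expR mulrBr mulrN ds mulrCA dv.
  by move: y1; lra.
have e2 : d%:R / (n%:R * expR (- s - 5 * v)) <= expR 5 * expR (- (b / 4 * y)).
  apply: (@le_trans _ _ (expR ((1 - b) * y) / (n%:R * expR (- s - 5 * v)))).
    by rewrite ler_wpM2r // invr_ge0 mulr_ge0 ?expR_ge0.
  rewrite ny -expRD -expRN -!expRD ler_expR.
  have := k1s_le; have := s_ge0; rewrite mulrDl mul1r.
  have : 0 <= k%:R * s by rewrite mulr_ge0 // s_ge0.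
  move: (k%:R * s) => ks; have := y_gt0; have hb0 := b0; move=> y0 ks0 s0 h.
  have : 0 < b * y by rewrite mulr_gt0.
  by lra.
apply: le_trans (lerD e1 e2) _; rewrite -[2 * _ * _]mulrA; move: (expR 5 * _) => A; lra.
Qed.

(** With [u = t v <= 1], the rate [4 v] makes all [m >= d/4] major edges absent with probability at
    most 1/2. The left side is then at most [(1 + expR (- u)) / 2 <= 1 - u/4]. *)
Lemma sprinkle_factor_le t m : (0 < d)%N -> (t <= d)%N -> (d <= 4 * m)%N ->
  expR (- v) ^+ t + (1 - expR (- v) ^+ t) * expR (- (4 * v)) ^+ m <= expR (- (v / 4)) ^+ t.
Proof.
move=> d0 td dm; rewrite -!expRM_natl !mulrN; pose u := t%:R * v.
have u01 : 0 <= u <= 1.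
  rewrite mulr_ge0 ?(ltW v0) //= -[X in _ <= X]dv ler_wpM2r ?(ltW v0) // ler_nat //.
have e1 : expR (- (m%:R * (4 * v))) <= 1 / 2.
  apply: le_trans (expRN1_le R); rewrite ler_expR lerN2 -[X in X <= _]dv mulrA ler_wpM2r ?(ltW v0) //.
  by rewrite -natrM mulnC ler_nat.
have e2 := expRN_le u01.
have e3 : 1 - u / 4 <= expR (- (t%:R * (v / 4))).
  by rewrite mulrA -/u; have := expR_ge1Dx (- (u / 4)); lra.
have e4 : expR (- u) <= 1 by rewrite expR_le1 oppr_le0; case/andP: u01.
rewrite -/u; apply: le_trans e3.
apply: (@le_trans _ _ (expR (- u) + (1 - expR (- u)) * (1 / 2))).
  by rewrite lerD2l ler_wpM2l // subr_ge0.
by move: e2; lra.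
Qed.

(** Dividing by [d] gives [t v + k >= 8 (k + 2) y r]. Since [y r >= 1], the loss [k] is at most
    [(k + 2) y r], and a quarter of the remaining 7 still exceeds 1. *)
Lemma link_exponent_le (c : R) t r : 0 < c -> (0 < r)%N ->
  c * (8 * (k%:R + 2) / c * d%:R * y * r%:R) <= (t + k * d)%:R ->
  expR (- (v / 4)) ^+ t <= expR (- ((k%:R + 2) * y)) ^+ r.
Proof.
move=> c0 r0 h; rewrite -!expRM_natl ler_expR !mulrN lerN2.
have {}h : 8 * (k%:R + 2) * y * r%:R <= t%:R * v + k%:R.
  have e0 : (t + k * d)%:R * v = t%:R * v + k%:R.
    by rewrite natrD natrM mulrDl -[k%:R * d%:R * v]mulrA dv mulr1.
  have := ler_wpM2r (ltW v0) h; rewrite e0.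
  apply: le_trans; rewrite le_eqVlt; apply/orP; left; apply/eqP.
  transitivity (8 * (k%:R + 2) * y * r%:R * (d%:R * v) * (c / c)).
    by rewrite dv divff ?gt_eqF // !mulr1.
  by ring.
have r1 : (1 : R) <= r%:R by rewrite ler1n.
have yr : 1 <= y * r%:R by rewrite -[X in X <= _]mulr1; apply: ler_pM.
have k0 : 0 <= k%:R + 2 :> R by rewrite addr_ge0.
have h2 := ler_wpM2l k0 yr.
have e1 : 8 * (k%:R + 2) * y * r%:R = 8 * ((k%:R + 2) * (y * r%:R)) by rewrite !mulrA.
have e2 : r%:R * ((k%:R + 2) * y) = (k%:R + 2) * (y * r%:R) by rewrite mulrC mulrA.
have e3 : t%:R * (v / 4) = t%:R * v / 4 by rewrite mulrA.
move: h h2; rewrite e1 e2 e3; move: ((k%:R + 2) * (y * _)) (t%:R * v) => A B.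
have : 0 <= k%:R :> R by [].
by move: (k%:R : R) => K *; lra.
Qed.

(** With [w = n^(-(k+2))], the sum over [Rt] is of order [n w = n^(-(k+1))], which beats the order
    [n^k] of choices for [S] by a factor [n]. *)
Lemma bad_cut_sum_le (T : finType) : #|T|%:R = expR y :> R ->
  #|[set S : {set T} | (#|S| < k)%N]|%:R * ((1 + expR (- ((k%:R + 2) * y))) ^+ #|T| - 1)
  <= 2 * expR 1 * expR (- (1 / 2 * y)).
Proof.
move=> ny; set w := expR _.
have T0 : (0 < #|T|)%N by rewrite -(ltr0n R) ny expR_gt0.
have nw : #|T|%:R * w = expR (- ((k%:R + 1) * y)).
  by rewrite ny /w -expRD; congr expR; ring.
have nw12 : 0 <= #|T|%:R * w <= 1 / 2.
  rewrite nw expR_ge0 /=; apply: le_trans (expRN1_le R); rewrite ler_expR lerN2.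
  have k0 : 0 <= k%:R :> R by [].
  by rewrite -[X in X <= _]mulr1; apply: ler_pM => //; rewrite lerDr.
have e1 : (1 + w) ^+ #|T| - 1 <= 2 * expR (- ((k%:R + 1) * y)).
  rewrite lerBlDl -nw; apply: le_trans (expR_le_lin nw12).
  rewrite expRM_natl lerXn2r ?nnegrE ?expR_ge0 ?addr_ge0 ?expR_ge0 //.
  exact: expR_ge1Dx.
apply: (@le_trans _ _ (expR 1 * expR (k%:R * y) * (2 * expR (- ((k%:R + 1) * y))))).
  apply: ler_pM => //.
    by rewrite subr_ge0 exprn_ege1 // lerDl expR_ge0.
  by apply: le_trans (card_small_sets R k T0) _; rewrite ny expRM_natl.
have -> : expR 1 * expR (k%:R * y) * (2 * expR (- ((k%:R + 1) * y)))
   = 2 * expR 1 * (expR (k%:R * y) * expR (- ((k%:R + 1) * y))) by ring.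
rewrite -expRD ler_wpM2l ?mulr_ge0 ?expR_ge0 // ler_expR mulrDl mul1r.
by have := y_gt0; move: (k%:R * y); move=> *; lra.
Qed.

End Estimates.

(** * Assembly and passage to the limit *)

Definition same_hitting_time (T : finType) (E : {set {set T}}) (k : nat)
    (s : #|E|.-tuple {set T}) :=
  hitting_time (min_degree_ge k) s == hitting_time (k_connected k) s.

Lemma same_hitting_prob_lower (R : realType) (k : nat) (c b : R) :
  (0 < k)%N -> 0 < c -> 0 < b -> b <= 1 / 2 ->
  exists y0 D : R, forall (T : finType) (E : {set {set T}}) (d : nat),
    simple_graph E -> regular d E -> (0 < #|T|)%N -> D <= d%:R -> y0 <= ln #|T|%:R ->
    d%:R <= expR ((1 - b) * ln #|T|%:R) ->
    (forall U : {set T}, #|U|%:R <= #|T|%:R / 2 :> R ->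
       c * #|U|%:R <= (edge_boundary E U)%:R) ->
    (forall U : {set T}, #|U|%:R <= 8 * (k%:R + 2) / c * d%:R * ln #|T|%:R ->
       19 / 20 * d%:R * #|U|%:R <= (edge_boundary E U)%:R :> R) ->
    1 - process_prob R (@same_hitting_time T E k)
    <= (2 * expR 5 + 3 + 2 * expR 1) * expR (- (b / 4 * ln #|T|%:R)).
Proof.
move=> k0 c0 b0 b1.
have [y1 [y11 h1]] := @expR_dominates R (4 * expR 1) (1 / 100) k.+1 ltac:(lra).
have [y2 [y21 h2]] := @expR_dominates R (expR 2) (b / 8) (2 * k) ltac:(lra).
(* The bound on [y] also gives [y >= 2] and [k < n]; the bound on [d] gives [(k + 1) / d <= b / 200]
   and [2 k <= d]. *)
exists (y1 + y2 + k%:R + 2), (200 * (k%:R + 1) / b) => T E d sE rE T0 hD hy hd hexp hsmall.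
have k00 : 0 <= k%:R :> R by [].
move: hy hd hsmall; set y := ln _ => hy hd hsmall.
have ny : #|T|%:R = expR y :> R by rewrite lnK // posrE ltr0n.
have yy1 : y1 <= y by lra.
have yy2 : y2 <= y by lra.
have y_2 : 2 <= y by lra.
have y_1 : 1 <= y by lra.
have kT : (k < #|T|)%N.
  rewrite -(ltr_nat R) ny; apply: lt_le_trans (expR_ge1Dx y); lra.
have hD' : 200 * (k%:R + 1) <= b * d%:R by rewrite -ler_pdivrMl // mulrC.
have dpos : 0 < d%:R :> R.
  by rewrite -(pmulr_rgt0 _ b0); apply: lt_le_trans hD'; lra.
have d0 : (0 < d)%N by rewrite -(ltr0n R).
have kd : (2 * k <= d)%N.
  rewrite -(ler_nat R) natrM.
  have : b * d%:R <= 1 / 2 * d%:R by rewrite ler_wpM2r // ltW.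
  by move: hD'; lra.
pose v : R := d%:R^-1.
have v0 : 0 < v by rewrite invr_gt0.
have dv : d%:R * v = 1 by rewrite divff // gt_eqF.
have kv : (k%:R + 1) * v <= b / 200.
  by rewrite ler_pdivrMr // mulrAC ler_pdivlMr // mulrC.
have v1 : v <= 1 by rewrite -[X in _ <= X]dv ler_peMl ?(ltW v0) // ler1n.
pose q0 := expR (- ((1 - b / 4) * y * v)).
pose L := 8 * (k%:R + 2) / c * d%:R * y.
have expN01 (u : R) : 0 <= u -> 0 < expR (- u) <= 1.
  by move=> u0; rewrite expR_gt0 expR_le1 oppr_le0.
have q1b : 0 < expR (- (4 * v)) <= 1 by apply: expN01; rewrite mulr_ge0 // ltW.
have q2b : 0 < expR (- v) <= 1 by apply: expN01; apply: ltW.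
have q2z : expR (- v) <= expR (- (v / 4)) by rewrite ler_expR lerN2; move: v0; lra.
have hg (W : {set T}) : (fun m : nat => m%:R <= L) #|W| ->
    (q0 + (1 - q0) * (q0 / y)) ^+ edge_boundary E W
    <= expR (1 - (1 - b / 4) * (19 / 20) * y) ^+ #|W|.
  move=> sW; apply: (mix_expr_le dv v0 y_1 b0 b1); first exact: edge_boundary_le.
  exact: hsmall.
have smallL (m : nat) : ~~ (m%:R <= L) -> L <= m%:R by rewrite -ltNge => /ltW.
have := @hitting_prob_bound R T E d k sE rE k0 kT kd q0 (expR (- (4 * v))) (expR (- v))
  (q0 / y) (expR (1 - (1 - b / 4) * (19 / 20) * y)) (expR (- (v / 4)))
  (expR (- ((k%:R + 2) * y))) c L (fun m => m%:R <= L)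
  (q0_bounds v0 y_1 b0 b1) q1b q2b (x_bounds v0 y_1 b0 b1) (expR_ge0 _) (ltW c0)
  (expR_ge0 _) q2z hg (fun t m => sprinkle_factor_le dv v0 d0) hexp smallL
  (fun t r => link_exponent_le dv v0 y_1 c0).
move=> /le_trans; apply.
have B1 := no_isolated_le dv v0 y_1 b0 b1 kv d0 ny hd.
have B3 := trap_sum_le dv v0 y_1 b0 b1 kv y_2 ny (h1 y yy1).
have B4 := low_pair_le dv v0 y_1 b0 b1 kv d0 ny (card_edges_le sE rE) hd (h2 y yy2).
have B5 := @bad_cut_sum_le R k y y_1 T ny.
apply: le_trans (lerD (lerD (lerD B1 B3) B4) B5) _.
have e12 : expR (- (1 / 2 * y)) <= expR (- (b / 4 * y)).
  rewrite ler_expR lerN2 ler_wpM2r //; first by lra.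
  by move: b1; lra.
have e1 : 0 <= expR 1 :> R := expR_ge0 _.
have := ler_wpM2l e1 e12; move: e12.
move: (expR (- (1 / 2 * y))) (expR (- (b / 4 * y))) (expR 5 : R) (expR 1 : R) => A B e5 e1'.
by lra.
Qed.

Lemma same_hitting_prob_le1 (R : realType) (k : nat) (T : finType) (E : {set {set T}}) :
  process_prob R (@same_hitting_time T E k) <= 1.
Proof.
rewrite -(sum_trajectory_prob R E) /process_prob [X in X <= _]big_mkcond.
apply: ler_sum => s _; case: ifP => // _.
by rewrite trajectory_probE; case: ifP => // _; rewrite invr_ge0.
Qed.

Lemma same_hitting_prob0 (R : realType) (T : finType) (E : {set {set T}}) :
  (0 < #|T|)%N -> process_prob R (@same_hitting_time T E 0) = 1.
Proof.
move=> T0; rewrite -(sum_trajectory_prob R E) /process_prob; apply: eq_bigl => s.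
rewrite /same_hitting_time /hitting_time /=.
have -> : min_degree_ge 0 (graph_at s 0) by apply/forallP.
have -> : k_connected 0 (graph_at s 0).
  by rewrite /k_connected T0; apply/forallP => S; rewrite ltn0.
by [].
Qed.

Local Open Scope classical_set_scope.

Theorem theorem1p1 (R : realType) :
  exists eps0 : R, 0 < eps0 /\
  forall (k : nat) (c : R), 0 < c ->
  exists C : R, 0 < C /\
  forall (a eps : R), 0 < a -> 0 < eps -> eps <= eps0 ->
  forall (d n : nat -> nat) (V : nat -> finType)
         (E : forall i, {set {set V i}}),
    (forall i, (0 < d i)%N) ->
    (forall i, (0 < n i)%N) ->
    n @ \oo --> \oo ->
    d @ \oo --> \oo ->
    (forall i, (d i)%:R <= (n i)%:R `^ (1 - a) :> R) ->
    (forall i, #|V i| = n i) ->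
    (forall i, simple_graph (E i)) ->
    (forall i, regular (d i) (E i)) ->
    (forall i (U : {set V i}), #|U|%:R <= (n i)%:R / 2 :> R ->
       c * #|U|%:R <= (edge_boundary (E i) U)%:R) ->
    (forall i (U : {set V i}), #|U|%:R <= C * (d i)%:R * ln (n i)%:R ->
       (1 - eps) * (d i)%:R * #|U|%:R <= (edge_boundary (E i) U)%:R) ->
  process_prob R (fun s : #|E i|.-tuple {set V i} =>
    hitting_time (min_degree_ge k) s == hitting_time (k_connected k) s)
    @[i --> \oo] --> (1 : R).
Proof.
(* This turns (P2) into expansion by the factor 19/20; the value of [C] on the next line is that of
   [link_exponent_le]. *)
exists (1 / 20); split; first lra.
move=> k c c0; exists (8 * (k%:R + 2) / c); split.
  by rewrite divr_gt0 // mulr_gt0 // ltr_wpDl.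
move=> a eps a0 e0 e1 d n V E d0 n0 noo doo hd hV sE rE hexp hsmall.
(* For [k = 0] both hitting times are 0; the isolated-vertex argument covers [k > 0]. *)
have [->|k0] := posnP k.
  rewrite (_ : (fun i => _) = fun=> 1 :> R); first exact: cvg_cst.
  by apply/funext => i; apply: same_hitting_prob0; rewrite hV.
pose b := Num.min a (1 / 2).
have b0 : 0 < b by rewrite lt_min a0 /=; lra.
have b1 : b <= 1 / 2 by rewrite ge_min lexx orbT.
have ba : b <= a by rewrite ge_min lexx.
have [y0 [D main]] := same_hitting_prob_lower k0 c0 b0 b1.
apply/cvgrPdist_le => e epos.
pose K : R := 2 * expR 5 + 3 + 2 * expR 1.
have K0 : 0 < K by rewrite /K; have := expR_gt0 (5 : R); have := expR_gt0 (1 : R); lra.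
(* From [y >= y1] it follows that [expR (b/4 y) >= b/4 y >= K / e], so the error is at most [e]. *)
pose y1 := 4 * K / (b * e).
pose N := Num.bound (expR (`|y0| + y1)); pose ND := Num.bound `|D|.
have big_n : \forall i \near \oo, (N <= n i)%N by exact: (noo _ (nbhs_infty_ge N)).
have big_d : \forall i \near \oo, (ND <= d i)%N by exact: (doo _ (nbhs_infty_ge ND)).
near=> i.
have Nn : (N <= n i)%N by near: i.
have Dd : (ND <= d i)%N by near: i.
have y10 : 0 < y1 by rewrite divr_gt0 // mulr_gt0.
have npos : 0 < (n i)%:R :> R by rewrite ltr0n.
have yge : `|y0| + y1 <= ln (n i)%:R.
  rewrite -ler_expR lnK ?posrE //; apply: (@le_trans _ _ N%:R); last by rewrite ler_nat.
  by apply: ltW; apply: archi_boundP; apply: expR_ge0.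
have lnn : 0 <= ln (n i)%:R :> R by rewrite ln_ge0 // ler1n.
have bnd := main (V i) (E i) (d i) (sE i) (rE i); rewrite hV in bnd.
have {}bnd := bnd (n0 i).
rewrite ger0_norm ?subr_ge0; last exact: same_hitting_prob_le1.
apply: (@le_trans _ _ (K * expR (- (b / 4 * ln (n i)%:R)))).
  apply: bnd.
  - apply: le_trans (ler_norm D) _; apply: (@le_trans _ _ ND%:R); last by rewrite ler_nat.
    by apply: ltW; apply: archi_boundP.
  - by apply: le_trans (ler_norm _) _; apply: le_trans yge; rewrite lerDl ltW.
  - apply: le_trans (hd i) _; rewrite /powR gt_eqF // ler_expR ler_wpM2r // lerD2l lerN2.
    exact: ba.
  - exact: hexp.
  - move=> U /hsmall; apply: le_trans.
    by rewrite !ler_wpM2r //; lra.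
have y1le : y1 <= ln (n i)%:R by apply: le_trans yge; rewrite lerDr.
move: y1le; move: (ln _) => y y1le.
have u0 : 0 < b / 4 * y by rewrite mulr_gt0 ?divr_gt0 // (lt_le_trans y10).
rewrite expRN ler_pdivrMr ?expR_gt0 //.
apply: (@le_trans _ _ (e * (b / 4 * y))).
  have : 4 * K <= y * (b * e) by rewrite -ler_pdivrMr ?mulr_gt0.
  have -> : e * (b / 4 * y) = y * (b * e) / 4 by ring.
  by move: (y * (b * e)) (K) => M K' h; lra.
by rewrite ler_wpM2l ?(ltW epos) //; apply: le_trans (expR_ge1Dx _); rewrite lerDr.
Unshelve. all: by end_near. Qed.
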